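(* Let $G$ be a finitely generated group which is residually torsion-free word-hyperbolic, i.e. for every $g \in G$ with $g \neq 1$ there exist a torsion-free word-hyperbolic group $C$ and a homomorphism $\phi : G \to C$ such that $\phi(g) \neq 1$. Then $F(G) = 1$.
   Context: For a group $G$, the Frattini subgroup $F(G)$ is defined as the intersection of all maximal subgroups of $G$, provided at least one maximal subgroup exists, and as $F(G) := G$ otherwise. (A maximal subgroup is a proper subgroup not contained in any strictly larger proper subgroup.) A word-hyperbolic group is a finitely generated group whose Cayley graph with respect to a finite generating set is $\delta$-hyperbolic for some $\delta \geq 0$, that is, for any geodesic triangle each side is contained in the closed $\delta$-neighborhood of the union of the other two sides. The homomorphism $\phi$ in the definition of residually torsion-free word-hyperbolic is not required to be surjective. *)

(* Defs.v *)
From mathcomp Require Import all_boot all_order all_algebra.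
From mathcomp Require Import boolp classical_sets set_interval reals.

Set Implicit Arguments.
Unset Strict Implicit.
Unset Printing Implicit Defensive.

Import Order.TTheory GRing.Theory Num.Theory.

Local Open Scope classical_set_scope.
Local Open Scope ring_scope.

Definition is_subgroup (G : groupType) (H : set G) : Prop :=
  [/\ H 1%g,
      forall x y, H x -> H y -> H (x * y)%g
    & forall x, H x -> H (x^-1)%g].

Definition maximal_subgroup (G : groupType) (M : set G) : Prop :=
  [/\ is_subgroup M, M != setT
    & forall H : set G, is_subgroup H -> H != setT -> ~ M `<` H].

(* An intersection over an empty family is [setT], so this is the whole group
   when there is no maximal subgroup. *)
Definition Frattini (G : groupType) : set G :=
  \bigcap_(M in [set M : set G | maximal_subgroup M]) M.
Arguments Frattini : clear implicits.

Definition generates (G : groupType) (S : seq G) : Prop :=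
  forall H : set G,
    is_subgroup H -> (forall s, s \in S -> H s) -> H = setT.

Definition finitely_generated (G : groupType) : Prop :=
  exists S : seq G, generates S.

Definition torsion_free (G : groupType) : Prop :=
  forall (x : G) (n : nat), (0 < n)%N -> (x ^+ n = 1 -> x = 1)%g.

Section Metric.
Variables (R : realType) (T : Type) (d : T -> T -> R).

Definition geodesic_segment (x y : T) (A : set T) : Prop :=
  exists (L : R) (gamma : R -> T),
    [/\ 0 <= L, gamma 0 = x, gamma L = y,
        {in `[0, L] &, forall a b, d (gamma a) (gamma b) = `|a - b|}
      & A = gamma @` [set` `[0, L]]].

Definition closed_neighborhood (delta : R) (A : set T) : set T :=
  [set p | exists2 q, A q & d p q <= delta].

Definition delta_hyperbolic (delta : R) : Prop :=
  forall (x y z : T) (A B C : set T),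
    geodesic_segment x y A -> geodesic_segment y z B ->
    geodesic_segment z x C ->
    [/\ A `<=` closed_neighborhood delta (B `|` C),
        B `<=` closed_neighborhood delta (C `|` A)
      & C `<=` closed_neighborhood delta (A `|` B)].

End Metric.

Section CayleyGraph.
Variables (R : realType) (G : groupType) (S : seq G).

(* The Cayley graph as a metric graph: its vertices are the elements of G, and
   each g in G and s in S give an edge of length 1 from g to g * s, whose
   interior point at distance t from g is [EdgePoint g s t]. *)
Inductive cayley_point : Type :=
| Vertex of G
| EdgePoint (g s : G) (t : R) of s \in S & 0 < t < 1.

(* [x] is an endpoint of the closed edge carrying [p] (or [p] itself, if [p] is
   a vertex), and the sub-arc of that edge from [p] to [x] has length [a]. *)
Definition arc_to_vertex (p : cayley_point) (x : G) (a : R) : Prop :=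
  match p with
  | Vertex g => x = g /\ a = 0
  | EdgePoint g s t _ _ =>
      (x = g /\ a = t) \/ (x = (g * s)%g /\ a = 1 - t)
  end.

Definition arc_in_edge (p q : cayley_point) (l : R) : Prop :=
  match p, q with
  | EdgePoint g s t _ _, EdgePoint h u v _ _ =>
      [/\ g = h, s = u & l = `|t - v|]
  | _, _ => False
  end.

(* Edges may be crossed in both directions. *)
Definition edge_path (x : G) (w : seq G) (y : G) : Prop :=
  all (fun c => (c \in S) || (c^-1 \in S)%g) w /\ y = (x * \prod_(c <- w) c)%g.

Definition path_length (p q : cayley_point) (l : R) : Prop :=
  arc_in_edge p q l \/
  exists (x y : G) (a b : R) (w : seq G),
    [/\ arc_to_vertex p x a, arc_to_vertex q y b, edge_path x w y
      & l = a + (size w)%:R + b].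

Definition cayley_dist (p q : cayley_point) : R :=
  inf [set l | path_length p q l].

End CayleyGraph.

Definition word_hyperbolic (R : realType) (G : groupType) : Prop :=
  exists2 S : seq G, generates S &
    exists2 delta : R, 0 <= delta &
      delta_hyperbolic (@cayley_dist R G S) delta.

Definition residually_torsion_free_hyperbolic
    (R : realType) (G : groupType) : Prop :=
  forall g : G, g <> 1%g ->
    exists C : groupType, [/\ torsion_free C, word_hyperbolic R C
      & exists phi : {multiplicative G -> C}, phi g <> 1%g].

(* Main.v *)
Require Import Defs.
From mathcomp Require Import all_boot all_order all_algebra.
From mathcomp Require Import boolp classical_sets set_interval reals.
From mathcomp Require Import zify lra.

(** Let [f] lie in the Frattini subgroup of [G], and suppose that some
    homomorphism [phi] to a torsion-free hyperbolic group [C] does not kill it.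
    Two facts about [Frattini G] drive the proof. It is normal
    ([Frattini_normal]), and it consists of nongenerators: every proper
    subgroup of a finitely generated group lies in a maximal one, so if [s_i]
    generate [G] and [b_i] lie in [Frattini G], then the elements [s_i b_i]
    still generate [G] ([Frattini_nongenerators]). The contradiction comes from
    a choice of the [b_i] for which the [phi (s_i b_i)] generate too little.

    The geometry of [C] enters only through its word length: this satisfies the
    four-point form of Gromov's inequality ([word_hyperbolic_length]).
    Replacing [f] by a power, the powers of [phi f] form a quasi-geodesic line,
    the axis ([exists_quasi_axis]). Let [E] be the commensurator of
    [<phi f>] in [C]. Since balls are finite, a translate of the axis by an
    element outside [E] diverges from the axis in all directions
    ([bounded_overlap]), and [<phi f>] has finite index in [E]
    ([commensurator_cover]).

    If infinitely many left cosets of [E] meet [phi (Frattini G)], choose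
    [alpha_i] in [phi s_i . phi (Frattini G)] and [beta_i] in
    [phi (Frattini G)], all in pairwise different cosets of [E]. For large [n]
    the elements [u_i = alpha_i (phi f)^n beta_i^-1] and their inverses start
    in pairwise divergent directions, so every nonempty reduced word in them is
    longer than [phi f] ([ping_pong]). But [u_i] has the form [phi (s_i b_i)],
    so the [u_i] generate [phi G], which contains [phi f] ([general_case]).

    If finitely many cosets of [E] suffice, then each conjugate of [phi f] by
    an element of [phi G] has a power in [<phi f>], which puts [phi G] inside
    [E]. The transfer then gives a homomorphism from [phi G] to the integers
    that is nonzero on [phi f] ([transfer]). A homomorphism [theta] to the
    integers must vanish on the Frattini subgroup ([Frattini_to_int]): with
    [m = theta f] and [b_i = f^(m theta(s_i))], all values of [theta] are
    multiples of [m^2 + 1], and so is [m] itself ([elementary_case]). *)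

Set Implicit Arguments.
Unset Strict Implicit.
Unset Printing Implicit Defensive.

Import Order.TTheory GRing.Theory Num.Theory.

Local Open Scope classical_set_scope.
Local Open Scope group_scope.

(** * Integer powers in a torsion-free group *)

Section IntegerPowers.
Variable C : groupType.
Implicit Types (x y : C) (m n : int).

Definition zpow x m : C :=
  match m with Posz k => x ^+ k | Negz k => x ^- k.+1 end.

Lemma zpowS x m : zpow x (m + 1)%R = zpow x m * x.
Proof.
case: m => [k|[|k]].
- by rewrite -PoszD addn1 /= expgSr.
- by rewrite /= expg1 mulVg.
- have -> : (Negz k.+1 + 1 = Negz k)%R by lia.
  by rewrite /= [x ^+ k.+2]expgS invgM mulgVK.
Qed.

Lemma zpow_pred x m : zpow x (m - 1)%R = zpow x m * x^-1.
Proof. by rewrite -{2}(subrK 1%R m) zpowS mulgK. Qed.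

Lemma zpowD x m n : zpow x (m + n)%R = zpow x m * zpow x n.
Proof.
elim/int_ind: n => [|k IH|k IH].
- by rewrite addr0 mulg1.
- have -> : (m + k.+1%:Z = m + k%:Z + 1)%R by lia.
  by rewrite zpowS IH -mulgA -expgSr.
- have -> : (m + - k.+1%:Z = m - k%:Z - 1)%R by lia.
  have -> : (- k.+1%:Z = - k%:Z - 1)%R by lia.
  by rewrite !zpow_pred IH mulgA.
Qed.

Lemma zpowN x m : zpow x (- m)%R = (zpow x m)^-1.
Proof. by apply/esym/mulg1_eq; rewrite -zpowD subrr. Qed.

Lemma zpowXn x m (k : nat) : zpow x m ^+ k = zpow x (m * k%:Z)%R.
Proof.
elim: k => [|k IH]; first by rewrite mulr0.
have -> : (m * k.+1%:Z = m * k%:Z + m)%R by lia.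
by rewrite zpowD expgSr IH.
Qed.

Lemma zpowA x m n : zpow (zpow x m) n = zpow x (m * n)%R.
Proof.
case: n => k; rewrite ?[LHS]/= zpowXn //.
have -> : (m * Negz k = - (m * k.+1%:Z))%R by lia.
by rewrite zpowN.
Qed.

Lemma zpow_conj x y m : y * zpow x m * y^-1 = zpow (y * x * y^-1) m.
Proof.
have conjX k : y * x ^+ k * y^-1 = (y * x * y^-1) ^+ k.
  elim: k => [|k IH]; first by rewrite mulg1 mulgV.
  by rewrite !expgS -IH -!mulgA mulKg.
case: m => k; first exact: conjX.
by rewrite /= -conjX !invgM invgK mulgA.
Qed.

Lemma zpow_eq1 x m : torsion_free C -> x <> 1 -> zpow x m = 1 -> m = 0%R.
Proof.
move=> tf x1; case: m => [[//|k]|k] /=.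
  by move=> /(tf _ _ (ltn0Sn _)).
move=> /(congr1 (fun y : C => y^-1)); rewrite invgK invg1.
by move=> /(tf _ _ (ltn0Sn _)).
Qed.

Lemma zpow_inj x m n : torsion_free C -> x <> 1 ->
  zpow x m = zpow x n -> m = n.
Proof.
move=> tf x1 e; apply/eqP; rewrite -subr_eq0; apply/eqP.
by apply: (zpow_eq1 tf x1); rewrite zpowD zpowN e mulgV.
Qed.

End IntegerPowers.

(** * Hyperbolic length functions *)

Section LengthDefs.
Variables (C : groupType) (len : C -> nat).

Definition gdist (x y : C) : nat := len (x^-1 * y).

(** The Gromov product of [x] and [z] at [y] is at most [k / 2]. Doubling it
    keeps all distances and constants in [nat]. *)
Definition nearly_between (k : nat) (x y z : C) : Prop :=
  gdist x y + gdist y z <= gdist x z + k.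

Record length_function : Prop := LengthFunction {
  length1 : len 1 = 0;
  lengthV : forall x, len x^-1 = len x;
  lengthM : forall x y, len (x * y) <= len x + len y }.

(** What the proof retains of the word metric of a hyperbolic group: finite
    balls, geodesics between any two elements, and the four-point inequality
    with constant [D]. *)
Record hyperbolic_length (D : nat) : Prop := HyperbolicLength {
  hyperbolic_length_function :> length_function;
  length_ball : forall r, exists B : seq C, forall x, len x <= r -> x \in B;
  length_geodesic : forall x i, i <= len x ->
    exists2 m, len m = i & len (m^-1 * x) = len x - i;
  four_point : forall x y z w,
    gdist x z + gdist y w <=
      maxn (gdist x y + gdist z w) (gdist x w + gdist y z) + D }.

End LengthDefs.

Section LengthMetric.
Variables (C : groupType) (len : C -> nat).
Hypothesis lenP : length_function len.
Local Notation d := (gdist len).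

Lemma gdist1 x : d 1 x = len x.
Proof. by rewrite /gdist invg1 mul1g. Qed.

Lemma gdistxx x : d x x = 0.
Proof. by rewrite /gdist mulVg (length1 lenP). Qed.

Lemma gdistC x y : d x y = d y x.
Proof. by rewrite /gdist -(lengthV lenP) invgM invgK. Qed.

Lemma gdist_triangle x y z : d x z <= d x y + d y z.
Proof.
rewrite /gdist; have -> : x^-1 * z = (x^-1 * y) * (y^-1 * z).
  by rewrite -mulgA mulVKg.
exact: (lengthM lenP).
Qed.

Lemma gdistM g x y : d (g * x) (g * y) = d x y.
Proof. by rewrite /gdist invgM -mulgA mulKg. Qed.

Lemma gdistMr x y : d x (x * y) = len y.
Proof. by rewrite -{1}[x]mulg1 gdistM gdist1. Qed.

End LengthMetric.

Section HyperbolicLength.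
Variables (C : groupType) (len : C -> nat) (D : nat).
Hypothesis hyp : hyperbolic_length len D.
Local Notation d := (gdist len).
Local Notation near := (nearly_between len).
Let gdistC := gdistC hyp.
Let gdist_triangle := gdist_triangle hyp.
Let gdistxx := gdistxx hyp.

Lemma nearC k x y z : near k x y z -> near k z y x.
Proof. by rewrite /nearly_between ![d z _]gdistC [d y x]gdistC addnC. Qed.

Lemma nearM k g x y z : near k x y z -> near k (g * x) (g * y) (g * z).
Proof. by rewrite /nearly_between !gdistM. Qed.

Lemma near_leq k k' x y z : k <= k' -> near k x y z -> near k' x y z.
Proof. by move=> kk' /leq_trans; apply; rewrite leq_add2l. Qed.

(** Gromov's inequality [(x|z) >= min((x|y), (y|z)) - delta] at [p], read as a
    case distinction. *)
Lemma near_split k x p y z :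
  near k x p z -> near (k + D) x p y \/ near (k + D) y p z.
Proof.
rewrite /nearly_between => H; have := four_point hyp x y z p.
rewrite [d z p]gdistC [d y p]gdistC [d p y]gdistC; lia.
Qed.

Lemma near_perturbl k x x' y z : near k x y z -> near (k + 2 * d x x') x' y z.
Proof.
rewrite /nearly_between => H.
have := gdist_triangle x' x y; have := gdist_triangle x x' z.
rewrite [d x' x]gdistC; lia.
Qed.

Lemma near_perturb k L x y z x' y' z' : near k x y z ->
  d x x' <= L -> d y y' <= L -> d z z' <= L -> near (k + 6 * L) x' y' z'.
Proof.
rewrite /nearly_between => H dx dy dz.
have := gdist_triangle x' x y'; have := gdist_triangle x y y'.
have := gdist_triangle y' z z'; have := gdist_triangle y' y z.
have := gdist_triangle x z' z; have := gdist_triangle x x' z'.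
rewrite [d x' x]gdistC [d y' y]gdistC [d z' z]gdistC; lia.
Qed.

(** Stability of quasi-geodesics in the form needed here: a point [y] nearly
    between the ends of a quasi-geodesic path is close to the path. Each [w i]
    makes [y] nearly between [w 0] and [w i], or between [w i] and [w n]; where
    the second alternative is lost, both hold up to one step, and the
    four-point inequality then brings [y] close to [w i]. *)
Lemma near_path (w : nat -> C) n s k k' y :
  (forall i, i < n -> d (w i) (w i.+1) <= s) ->
  (forall i, i <= n -> near k (w 0) (w i) (w n)) ->
  near k' (w 0) y (w n) ->
  exists2 i, i <= n & d y (w i) <= k + k' + 2 * D + 2 * s.
Proof.
move=> step wgeo yn.
have [i [ilen near0 nearn]] : exists i, [/\ i <= n,
    near (k' + D + 2 * s) (w 0) y (w i) & near (k' + D + 2 * s) (w i) y (w n)].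
  case: (pselect (exists2 i, i < n &
      near (k' + D) (w i) y (w n) /\ ~ near (k' + D) (w i.+1) y (w n))).
    move=> [i ilt [ni nS]]; exists i; split; first exact: ltnW.
    - have [n0|//] := near_split (w i.+1) yn.
      have := near_perturbl (w i) (nearC n0); rewrite [d _ (w i)]gdistC => h.
      apply: nearC; have := step _ ilt; move: h; rewrite /nearly_between; lia.
    - by move: ni; rewrite /nearly_between; lia.
  move=> nsw; have all i : i <= n -> near (k' + D) (w i) y (w n).
    elim: i => [|i IH] lein; first by move: yn; rewrite /nearly_between; lia.
    by apply: contrapT => no; apply: nsw; exists i => //; split=> //;
      apply: IH; exact: ltnW.
  exists n; split=> //; first by move: yn; rewrite /nearly_between; lia.
  by have := all n (leqnn _); rewrite /nearly_between; lia.
exists i => //.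
have := wgeo _ ilen; move: near0 nearn; rewrite /nearly_between.
have := four_point hyp (w 0) y (w n) (w i).
rewrite [d y (w i)]gdistC [d y (w n)]gdistC ?[d (w n) _]gdistC; lia.
Qed.

(** A path with long steps and small Gromov products at its corners runs away
    from its origin. By induction, the Gromov product of [w j] and [w 0] at
    [w j.+1] is large, because the last step is long; so the corner at
    [w j.+1] forces that of [w 0] and [w j.+2] to be small. *)
Lemma local_to_global (w : nat -> C) n k M : 0 < M ->
  (forall i, i < n -> k + D + M <= d (w i) (w i.+1)) ->
  (forall i, i.+1 < n -> near k (w i) (w i.+1) (w i.+2)) ->
  forall j, j < n -> near (k + D) (w 0) (w j) (w j.+1) /\
    M * j.+1 <= d (w 0) (w j.+1).
Proof.
move=> M0 long turn; elim=> [|j IH] jn.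
  have := long _ jn; rewrite /nearly_between gdistxx; lia.
have [nj dj] := IH (ltnW jn).
have := near_split (w 0) (turn _ jn).
have := long _ (ltnW jn); have := long _ jn.
move: nj dj; rewrite /nearly_between ![d _ (w 0)]gdistC.
move=> nj dj lj lj1 []; lia.
Qed.

(** The powers of [f] form a quasi-geodesic line: as
    [d (f ^- i) (f ^+ j) = len (f ^+ (i + j))], the first condition bounds the
    Gromov product at [1] of any negative and any positive power. *)
Definition quasi_axis (K : nat) (f : C) : Prop :=
  (forall i j, len (f ^+ i) + len (f ^+ j) <= len (f ^+ (i + j)) + K) /\
  (forall n, n <= len (f ^+ n)).

Lemma gdistX (f : C) i j : i <= j -> d (f ^+ i) (f ^+ j) = len (f ^+ (j - i)).
Proof. by move=> ij; rewrite -{1}(subnKC ij) expgnDr gdistMr. Qed.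

(** If squaring lengthens [f] by more than [4 * D], the steps of the path of
    powers of [f] exceed the Gromov products at its corners by enough for
    [local_to_global] to apply. *)
Lemma quasi_axis_square (f : C) :
  len f + 4 * D + 1 <= len (f ^+ 2) -> quasi_axis (2 * len f) f.
Proof.
move=> sq; have le2 : len (f ^+ 2) <= 2 * len f.
  by have := lengthM hyp f f; rewrite -expg2; lia.
set k := 2 * len f - len (f ^+ 2).
pose w i := f ^+ i.
have step i : d (w i) (w i.+1) = len f.
  by rewrite gdistX ?subSnn ?expg1.
have turn i : near k (w i) (w i.+1) (w i.+2).
  rewrite /nearly_between !step gdistX; last by lia.
  have -> : i.+2 - i = 2 by lia.
  lia.
have w0 i : d (w 0) (w i) = len (f ^+ i) by rewrite gdistX // subn0.
have glob j : len (f ^+ j) + len f <= len (f ^+ j.+1) + (k + D) /\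
    j.+1 <= len (f ^+ j.+1).
  have [] := @local_to_global w j.+1 k 1 isT _ _ j (ltnSn j).
  - by move=> i _; rewrite step; lia.
  - by move=> i _; exact: turn.
  - by rewrite /nearly_between step !w0; lia.
split; last by case=> [|n]; rewrite ?(length1 hyp) //; have [] := glob n.
move=> i [|j]; first by rewrite addn0 (length1 hyp); lia.
have nj : near (k + D) (w 0) (w i) (w i.+1).
  by rewrite /nearly_between step !w0; have [] := glob i.
have := near_split (w (i + j.+1)) nj; rewrite /nearly_between !w0 step.
rewrite ![d (w (i + _)) _]gdistC !gdistX ?leq_addr //; last by lia.
have -> : i + j.+1 - i = j.+1 by lia.
have -> : i + j.+1 - i.+1 = j by lia.
have [+ _] := glob j; have [+ _] := glob i; lia.
Qed.

End HyperbolicLength.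

(** * Elements of infinite order *)

Lemma pigeonhole_nat (T : eqType) (s : seq T) (h : nat -> T) :
  (forall i, i <= size s -> h i \in s) ->
  exists i j, [/\ i < j, j <= size s & h i = h j].
Proof.
move=> hs; have : ~~ uniq [seq h i | i <- iota 0 (size s).+1].
  apply/negP => u; suff : (size s).+1 <= size s by rewrite ltnn.
  rewrite -{1}(size_iota 0 (size s).+1) -(size_map h).
  apply: (uniq_leq_size u).
  by move=> y /mapP [i]; rewrite mem_iota => /andP [_ lt] ->; apply: hs.
move=> /(uniqPn (h 0)) [i [j [ij]]]; rewrite size_map size_iota => jlt.
rewrite !(nth_map 0) ?size_iota //; last exact: ltn_trans ij jlt.
rewrite !nth_iota ?add0n //; last exact: ltn_trans ij jlt.
by move=> e; exists i, j.
Qed.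

Lemma expg_inj (C : groupType) (f : C) i j : torsion_free C -> f <> 1 ->
  f ^+ i = f ^+ j -> i = j.
Proof. by move=> tf f1 e; case: (@zpow_inj C f i%:Z j%:Z tf f1 e). Qed.

Section Powers.
Variables (C : groupType) (len : C -> nat) (D : nat).
Hypothesis hyp : hyperbolic_length len D.
Hypothesis tf : torsion_free C.
Local Notation d := (gdist len).
Local Notation near := (nearly_between len).

Lemma powers_unbounded (f : C) r : f <> 1 -> exists n, r < len (f ^+ n).
Proof.
move=> f1; have [B inB] := length_ball hyp r.
apply: contrapT => no.
have inB' n : n <= size B -> f ^+ n \in B.
  by move=> _; apply: inB; rewrite leqNgt; apply/negP => lt; apply: no; exists n.
have [i [j [ij _ e]]] := pigeonhole_nat inB'.
by have := expg_inj tf f1 e; lia.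
Qed.

(** The powers of an element of infinite order grow linearly on average. Take
    a power [g] of [f] much longer than [L], and the midpoint [m] of a geodesic
    from [1] to [g]. The powers [f ^+ j] of length at most [L] commute with
    [g], hence move both ends of that geodesic by at most [L]; so
    [f ^+ j * m] stays near the part of the geodesic at distance at most [L]
    from [m]. Only [(2 * L + 1) * V] points lie there, and the [f ^+ j * m]
    are distinct. *)
Lemma powers_counting : exists V, forall (f : C) J L, f <> 1 ->
  (forall j, j < J -> len (f ^+ j) <= L) -> J <= (2 * L + 1) * V.
Proof.
have [B inB] := length_ball hyp (3 * D).
exists (size B) => f J L f1 small.
have [n gbig] := powers_unbounded (2 * (L + 2 * D) + 4) f1.
set g := f ^+ n in gbig.
have halfg := odd_double_half (len g).
set i := (len g)./2 in halfg.
have ileg : i <= len g by lia.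
have [m lm lmg] := length_geodesic hyp ileg.
have dmg : d m g = len g - i by [].
have /choice [p pP] : forall t, exists p, t <= len g ->
    len p = t /\ len (p^-1 * g) = len g - t.
  move=> t; case: (leqP t (len g)) => [tg|_]; last by exists 1.
  by have [q lq lqg] := length_geodesic hyp tg; exists q.
pose t j := len (f ^+ j * m).
have near_y j : j < J ->
    [/\ i - L <= t j, t j <= i + L & near (2 * D) 1 (f ^+ j * m) g].
  move=> jJ; have lj := small _ jJ.
  have tle : t j <= i + L.
    by have := lengthM hyp (f ^+ j) m; rewrite -/(t j) lm; lia.
  have tge : i - L <= t j.
    have := lengthM hyp (f ^- j) (f ^+ j * m).
    by rewrite mulKg (lengthV hyp) lm -/(t j); lia.
  have nm : near 0 1 m g. by rewrite /nearly_between !gdist1 dmg lm; lia.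
  have d1j : d 1 (f ^- j) <= L by rewrite gdist1 (lengthV hyp).
  have gj : f ^- j * g = g * f ^- j.
    by rewrite /g; apply/esym/commuteV/commuteX2.
  have dgj : d (f ^- j * g) g <= L.
    by rewrite gj (gdistC hyp) (gdistMr) (lengthV hyp).
  split=> //.
  (* moving the ends of the geodesic by at most [L] does not affect [m] *)
  have nm1 : near D (f ^- j) m g.
    have [|] := near_split hyp (f ^- j) nm; rewrite /nearly_between.
      have := gdist_triangle hyp 1 (f ^- j) m; rewrite !gdist1 lm in d1j *.
      by rewrite [d m _](gdistC hyp); lia.
    by rewrite add0n.
  have nm2 : near (2 * D) (f ^- j) m (f ^- j * g).
    have [|] := near_split hyp (f ^- j * g) nm1; rewrite /nearly_between.
      lia.
    have := gdist_triangle hyp m (f ^- j * g) g.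
    by rewrite [d m (f ^- j * g)](gdistC hyp) dmg; lia.
  move: nm2; rewrite /nearly_between -!(gdistM len (f ^+ j) (f ^- j)).
  by rewrite -!(gdistM len (f ^+ j) m) mulgV mulVKg.
(* The position of [f ^+ j * m] along the geodesic [p] from 1 to [g], and its
   displacement from that point, determine [j]. *)
pose code j := (t j, (p (t j))^-1 * (f ^+ j * m)).
have sub : forall x, x \in [seq code j | j <- iota 0 J] ->
    x \in [seq (a, b) | a <- iota (i - L) (2 * L + 1), b <- B].
  move=> x /mapP [j]; rewrite mem_iota add0n => /andP [_ jJ] ->.
  have [tge tle ny] := near_y j jJ.
  apply/allpairsP; exists (code j) => /=; split=> //.
    by rewrite mem_iota; lia.
  have tg : t j <= len g by lia.
  have [lp lpg] := pP _ tg.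
  apply: inB; rewrite -/(d _ _).
  have := four_point hyp 1 (p (t j)) g (f ^+ j * m).
  move: ny; rewrite /nearly_between !gdist1 lp -/(t j) [d g _](gdistC hyp).
  rewrite [d (p (t j)) g]/gdist lpg; lia.
have un : uniq [seq code j | j <- iota 0 J].
  rewrite map_inj_in_uniq ?iota_uniq // => j j' _ _ [] -> /mulgI /mulIg.
  exact: expg_inj.
by have := uniq_leq_size un sub; rewrite size_allpairs size_map !size_iota.
Qed.

(** If no power of [f] satisfied the criterion of [quasi_axis_square], doubling
    the exponent would add only a constant to the length, and the length of
    [f ^+ j] would be logarithmic in [j], against [powers_counting]. *)
Lemma exists_quasi_axis (f : C) : f <> 1 ->
  exists N K, 0 < N /\ quasi_axis len K (f ^+ N).
Proof.
move=> f1; have [V count] := powers_counting.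
suff [N [N0 big]] : exists N, 0 < N /\ len (f ^+ N) + 4 * D + 1 <= len (f ^+ (2 * N)).
  exists N, (2 * len (f ^+ N))%N; split=> //; apply: (quasi_axis_square hyp).
  by rewrite -expgnA (mulnC N).
apply: contrapT => no.
have slow n : len (f ^+ (2 * n)) <= len (f ^+ n) + 4 * D.
  case: n => [|n]; first by rewrite muln0 (length1 hyp).
  by rewrite leqNgt; apply/negP => lt; apply: no; exists n.+1; split=> //; lia.
set a := 4 * D + len f.
have logb k j : j < 2 ^ k -> len (f ^+ j) <= k * a.
  elim: k j => [|k IH] j; first by case: j => //; rewrite (length1 hyp).
  rewrite expnS => jk; have e := odd_double_half j.
  have jk2 : j./2 < 2 ^ k by lia.
  have := IH _ jk2; have := slow j./2.
  (* binary expansion: at most [a] is added for each digit of [j] *)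
  have -> : f ^+ j = f ^+ odd j * f ^+ (2 * j./2).
    by rewrite -expgnDr mul2n e.
  move=> sl lj; apply: leq_trans (lengthM hyp _ _) _.
  have : len (f ^+ odd j) <= len f.
    by case: (odd j); rewrite ?expg1 ?(length1 hyp).
  by rewrite (mulSn k); lia.
have [q qE] : exists q, q = ((2 * a + 1) * V)%N by eexists.
have := count f (2 ^ (2 * q + 2))%N ((2 * q + 2) * a)%N f1 (logb _).
have -> : (2 * q + 2 = q.+1 + q.+1)%N by lia.
rewrite expnD expnS; have : q < 2 ^ q by exact: ltn_expl.
move: (2 ^ q)%N => y qy.
have : ((2 * ((q.+1 + q.+1) * a) + 1) * V <= 2 * q.+1 * q)%N.
  by rewrite [X in _ <= _ * X]qE [X in _ <= X]mulnA leq_mul2r; apply/orP; right; nia.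
nia.
Qed.

End Powers.

(** * The commensurator of a cyclic subgroup *)

Definition commensurates (C : groupType) (f x : C) : Prop :=
  exists p q : int, p <> 0%R /\ x * zpow f p = zpow f q * x.

(** [f ^+ n], or [f ^- n] when [b] is true: the sign selects an end of the axis
    of [f]. *)
Definition spow (C : groupType) (b : bool) (f : C) (n : nat) : C :=
  if b then f ^- n else f ^+ n.

Definition sint (b : bool) (n : nat) : int := (if b then - n%:Z else n%:Z)%R.

Lemma spow0 (C : groupType) b (f : C) : spow b f 0 = 1.
Proof. by case: b; rewrite /spow ?invg1. Qed.

Section Axis.
Variables (C : groupType) (len : C -> nat) (D : nat).
Hypothesis hyp : hyperbolic_length len D.
Hypothesis tf : torsion_free C.
Variables (f : C) (K : nat).
Hypothesis f1 : f <> 1.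
Hypothesis axis : quasi_axis len K f.
Local Notation d := (gdist len).
Local Notation near := (nearly_between len).

Lemma commensuratesV x : commensurates f x -> commensurates f x^-1.
Proof.
move=> [p [q [p0 e]]]; exists q, p; split.
  move=> q0; apply: p0; move: e; rewrite q0 mul1g => e.
  by apply: (zpow_eq1 tf f1); apply: (@mulgI _ x); rewrite e mulg1.
by apply: (@mulgI _ x); rewrite mulVKg mulgA e mulgK.
Qed.

Lemma len_zpow m : len (zpow f m) = len (f ^+ `|m|%N).
Proof. by case: m => k //=; rewrite (lengthV hyp). Qed.

Lemma gdist_zpow m n : d (zpow f m) (zpow f n) = len (f ^+ `|(n - m)%R|%N).
Proof. by rewrite /gdist -zpowN -zpowD len_zpow addrC. Qed.

Lemma near_zpow i j k : (i <= j)%R -> (j <= k)%R ->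
  near K (zpow f i) (zpow f j) (zpow f k).
Proof.
move=> ij jk; rewrite /nearly_between !gdist_zpow.
have -> : `|(k - i)%R|%N = `|(j - i)%R|%N + `|(k - j)%R|%N by lia.
by case: axis.
Qed.

Lemma spowE b n : spow b f n = zpow f (sint b n).
Proof. by case: b; rewrite /spow /sint ?zpowN. Qed.

Lemma gdist_spow b i j : d (spow b f i) (spow b f j) = len (f ^+ `|(i%:Z - j%:Z)%R|%N).
Proof.
by rewrite !spowE gdist_zpow; congr (len (f ^+ _)); case: b; rewrite /sint; lia.
Qed.

Lemma near_spow b i j k : i <= j -> j <= k ->
  near K (spow b f i) (spow b f j) (spow b f k).
Proof.
move=> ij jk; rewrite !spowE /sint; case: b.
  by apply: (nearC hyp); apply: near_zpow; lia.
by apply: near_zpow; lia.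
Qed.

Lemma len_pow_le n : len (f ^+ n) <= n * len f.
Proof.
elim: n => [|n IH]; first by rewrite (length1 hyp).
by rewrite expgS mulSn; apply: leq_trans (lengthM hyp _ _) _; rewrite leq_add2l.
Qed.

(** If the ray of [f] in direction [b] and the translate by [x] of the ray in
    direction [b'] had unbounded Gromov product, then arbitrarily long initial
    parts of the first would stay at bounded distance from the second. Balls
    being finite, two of the differences between nearby points agree, which is
    a relation [x * zpow f p = zpow f q * x]. *)
Lemma bounded_overlap b b' x : ~ commensurates f x ->
  exists T, forall n, near T (spow b f n) 1 (x * spow b' f n).
Proof.
move=> nx.
have [B inB] := length_ball hyp (K + (K + D + 2 * len x) + 2 * D + 2 * len f).
(* [I] steps along the first ray suffice for the pigeonhole principle, so the
   Gromov product has to exceed their total length. *)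
set I := size B.
exists (2 * (I * len f) + K + D)%N; apply: contrapT => /existsNP [n far].
set u := spow b f n in far; set v := x * spow b' f n in far.
have lenu i : len (spow b f i) <= i * len f.
  rewrite spowE len_zpow; apply: leq_trans (len_pow_le _) _.
  by case: b {far u}; rewrite /sint; lia.
have In : I <= n.
  rewrite leqNgt; apply/negP => ltn; apply: far; rewrite /nearly_between.
  have := gdist_triangle hyp 1 u v; have := lenu n; rewrite -/u -gdist1.
  rewrite [d u 1](gdistC hyp).
  have : n * len f <= I * len f by rewrite leq_mul2r (ltnW ltn) orbT.
  lia.
have wit i : i <= I -> exists j, (spow b f i)^-1 * (x * spow b' f j) \in B.
  move=> iI; set y := spow b f i.
  have ly : len y <= I * len f.
    by apply: leq_trans (lenu i) _; rewrite leq_mul2r iI orbT.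
  have ny : near K 1 y u.
    rewrite -(spow0 b f); apply: near_spow => //; exact: leq_trans iI In.
  have nyv : near (K + D) 1 y v.
    have [//|nvu] := near_split hyp v ny.
    case: far; move: nvu; rewrite /nearly_between.
    have := gdist_triangle hyp 1 y u; have := gdist_triangle hyp 1 y v.
    rewrite [d v y](gdistC hyp) [d v u](gdistC hyp) [d u 1](gdistC hyp).
    rewrite -gdist1 in ly; lia.
  have := near_perturbl hyp x nyv; rewrite gdist1 => nxv.
  have [|||j jn dj] := @near_path _ _ _ hyp (fun j => x * spow b' f j) n
     (len f) K (K + D + 2 * len x)%N y _ _ _.
  - move=> j _; rewrite gdistM gdist_spow.
    by have -> : `|(j%:Z - j.+1%:Z)%R|%N = 1%N by lia.
  - by move=> j jn; apply: nearM; exact: near_spow.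
  - by rewrite spow0 mulg1; exact: nxv.
  by exists j; apply: inB.
have /choice [j jP] : forall i, exists j, i <= I ->
    (spow b f i)^-1 * (x * spow b' f j) \in B.
  move=> i; case: (leqP i I) => [/wit [j jB]|_]; last by exists 0.
  by exists j.
have [i [i' [ii' _]]] := pigeonhole_nat jP.
rewrite !spowE => e; apply: nx.
exists (sint b' (j i') - sint b' (j i))%R, (sint b i' - sint b i)%R.
have eq : x * zpow f (sint b' (j i') - sint b' (j i))%R =
    zpow f (sint b i' - sint b i)%R * x.
  rewrite !zpowD !zpowN; apply: (@mulIg _ (zpow f (sint b' (j i))%R)).
  by rewrite mulgA mulgVK -!mulgA e mulVKg.
split=> // j0; move: eq; rewrite j0 mulg1 => /esym eq.
have := zpow_eq1 tf f1 (mulIg _ _ _ (etrans eq (esym (mul1g x)))).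
by rewrite /sint; case: (b); lia.
Qed.

(** If [x] commensurates [<f>], the line [x <f>] has the same two ends as [<f>],
    hence passes within a distance of [1] that does not depend on [x]: far
    enough out, the error [len x] in the position of the ends is negligible. *)
Lemma commensurator_cover : exists B : seq C, forall x,
  commensurates f x -> exists2 b, b \in B & exists z, x = b * zpow f z.
Proof.
have [B inB] := length_ball hyp (K + (K + 2 * D) + 2 * D + 2 * len f).
exists B => x [p [q [p0 e]]].
wlog p0 : p q e {p0} / (0 < p)%R.
  move=> th; case: (ltrP 0%R p) => [/(th _ _ e) //|ple].
  apply: (th (- p)%R (- q)%R); last by lia.
  rewrite !zpowN; apply: (@mulgI _ (zpow f q)).
  by rewrite mulVKg mulgA -e mulgK.
set j := len x + K + 2 * D + 1.
have ej (i : int) : x * zpow f (p * i)%R = zpow f (q * i)%R * x.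
  have h : x * zpow f p * x^-1 = zpow f q by rewrite e mulgK.
  by rewrite -[X in zpow f X * x]/(q * i)%R -!zpowA -h -zpow_conj mulgVK.
have q0 : q <> 0%R.
  move=> q0; move: e; rewrite q0 mul1g -[RHS]mulg1 => /mulgI /(zpow_eq1 tf f1).
  by lia.
set n := (`|p| * j)%N.
pose w i := x * zpow f (i%:Z - n%:Z)%R.
have w0 : w 0 = zpow f (q * - j%:Z)%R * x.
  by rewrite -ej /w; congr (_ * zpow f _); rewrite /n; lia.
have w2n : w (2 * n)%N = zpow f (q * j%:Z)%R * x.
  by rewrite -ej /w; congr (_ * zpow f _); rewrite /n; lia.
have big (i : int) : `|i|%N = j -> j <= len (zpow f (q * i)%R).
  move=> ij; rewrite len_zpow; apply: leq_trans (axis.2 _).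
  rewrite abszM ij; have : 0 < `|q|%N by lia.
  nia.
have nj : near K (zpow f (q * - j%:Z)%R) 1 (zpow f (q * j%:Z)%R).
  case: (ltrP 0%R q) => qs.
    by apply: (@near_zpow _ 0%R); nia.
  by apply: (nearC hyp); apply: (@near_zpow _ 0%R); nia.
have endx (i : int) y k : `|i|%N = j -> k <= K + D ->
    near k (zpow f (q * i)%R) 1 y -> near (k + D) (zpow f (q * i)%R * x) 1 y.
  move=> ij kK /(near_split hyp (zpow f (q * i)%R * x)) [|//].
  rewrite /nearly_between gdistMr [d _ 1](gdistC hyp) !gdist1.
  by have := big _ ij; rewrite /j; lia.
have near1 : near (K + 2 * D) (w 0) 1 (w (2 * n)%N).
  have -> : K + 2 * D = K + D + D by lia.
  rewrite w0 w2n; apply: (nearC hyp).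
  apply: (endx (Posz j)) => //; apply: (nearC hyp).
  by apply: (endx (- Posz j)%R) => //; lia.
have [||i ile di] := @near_path _ _ _ hyp w (2 * n) (len f) K _ 1 _ _ near1.
- move=> i _; rewrite gdistM gdist_zpow.
  by have -> : `|(i.+1%:Z - n%:Z - (i%:Z - n%:Z))%R|%N = 1%N by lia.
- by move=> i ile; apply: nearM; apply: near_zpow; lia.
exists (w i); first by apply: inB; rewrite -gdist1.
by exists (n%:Z - i%:Z)%R; rewrite -mulgA -zpowD addrA subrK subrr mulg1.
Qed.

End Axis.

(** * Transfer to a cyclic subgroup of finite index *)

Section Transfer.
Variables (C : groupType) (H : set C) (f : C).
Hypothesis tf : torsion_free C.
Hypothesis f1 : f <> 1.
Hypothesis Hgrp : is_subgroup H.
Hypothesis Hf : H f.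

Let H1 : H 1. Proof. by case: Hgrp. Qed.
Let HM x y : H x -> H y -> H (x * y). Proof. by case: Hgrp => _ + _; apply. Qed.
Let HV x : H x -> H x^-1. Proof. by case: Hgrp => _ _; apply. Qed.

Lemma subgroup_zpow z : H (zpow f z).
Proof.
have HX k : H (f ^+ k) by elim: k => [|k IH] //; rewrite expgS; apply: HM.
by case: z => k //=; apply: HV.
Qed.

(** Multiplication by [h] permutes the left cosets of [<f>]; on representatives
    [r] it reads [h * r = r' * zpow f (v h r)], and [theta h] is the sum of the
    [v h r]. A power [f ^+ n] commuting with all representatives contributes
    [n] for each coset, so [theta f] does not vanish. *)
Lemma transfer (B : seq C) :
  (forall h, H h -> exists2 b, b \in B & exists z, h = b * zpow f z) ->
  (forall h, H h -> exists2 n, 0 < n & commute h (f ^+ n)) ->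
  exists theta : C -> int,
    (forall g h, H g -> H h -> theta (g * h) = (theta g + theta h)%R) /\
    theta f <> 0%R.
Proof.
move=> cover central.
pose same x y := exists z, x = y * zpow f z.
have sameC x y : same x y -> same y x.
  by move=> [z ->]; exists (- z)%R; rewrite -mulgA -zpowD subrr mulg1.
have same_trans x y t : same x y -> same y t -> same x t.
  by move=> [z ->] [z' ->]; exists (z' + z)%R; rewrite zpowD mulgA.
have sameM g x y : same x y -> same (g * x) (g * y).
  by move=> [z ->]; exists z; rewrite mulgA.
pose rep x := nth 1 B (find (fun b => `[< same x b >]) B).
have repP x : H x -> same x (rep x) /\ rep x \in B.
  move=> Hx; have hasx : has (fun b => `[< same x b >]) B.
    by have [b bB xb] := cover x Hx; apply/hasP; exists b => //; apply/asboolP.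
  split; first by apply/asboolP; exact: (nth_find 1 hasx).
  by apply: mem_nth; rewrite -has_find.
have rep_same x y : same x y -> rep x = rep y.
  move=> xy; rewrite /rep; congr (nth 1 B _); apply: eq_find => b.
  by apply/asboolP/asboolP; apply: same_trans => //; apply: sameC.
have Hrep x : H x -> H (rep x).
  move=> Hx; have [/sameC [z ->] _] := repP x Hx.
  by apply: HM => //; exact: subgroup_zpow.
(* [rep] picks the same element of [B] for all members of a coset, and [R]
   consists of the elements picked. *)
pose R := [seq b <- undup B | `[< H b /\ rep b = b >]].
have RP b : reflect (H b /\ rep b = b) (b \in R).
  rewrite mem_filter mem_undup; apply: (iffP andP) => [[/asboolP]//|[Hb rb]].
  by split; [apply/asboolP|rewrite -rb; have [] := repP b Hb].
have repR x : H x -> rep x \in R.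
  move=> Hx; apply/RP; split; first exact: Hrep.
  by apply/rep_same/sameC; have [] := repP x Hx.
have uR : uniq R by rewrite filter_uniq ?undup_uniq.
pose act h r := rep (h * r).
have actR h r : H h -> r \in R -> act h r \in R.
  by move=> Hh /RP [Hr _]; apply/repR/HM.
have /choice [v0 v0P] : forall hr, exists z, H hr.1 -> hr.2 \in R ->
    hr.1 * hr.2 = act hr.1 hr.2 * zpow f z.
  move=> [h r] /=; case: (pselect (H h /\ r \in R)) => [[Hh rR]|no].
    have /RP [Hr _] := rR; have [[z e] _] := repP _ (HM Hh Hr).
    by exists z.
  by exists 0%R => Hh rR; case: no.
pose v h r := v0 (h, r).
have vP h r : H h -> r \in R -> h * r = act h r * zpow f (v h r).
  by move=> Hh rR; exact: (v0P (h, r)).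
have act_perm h : H h -> perm_eq [seq act h r | r <- R] R.
  move=> Hh; have inj : {in R &, injective (act h)}.
    move=> r r' /[dup] rR /RP [Hr er] /[dup] rR' /RP [Hr' er'] e.
    rewrite -er -er'; apply: rep_same; rewrite -(mulKg h r) -(mulKg h r').
    apply: sameM; rewrite (vP h r Hh rR) (vP h r' Hh rR') e.
    by exists (- v h r' + v h r)%R; rewrite -mulgA -zpowD addrA subrr add0r.
  have uact : uniq [seq act h r | r <- R] by rewrite map_inj_in_uniq.
  have sub : {subset [seq act h r | r <- R] <= R}.
    by move=> _ /mapP [r rR ->]; exact: actR.
  have [_ eqi] := uniq_min_size uact sub (eq_leq (esym (size_map _ _))).
  exact: uniq_perm.
pose theta h := (\sum_(r <- R) v h r)%R.
have thetaM g h : H g -> H h -> theta (g * h) = (theta g + theta h)%R.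
  move=> Hg Hh; rewrite /theta.
  have -> : (\sum_(r <- R) v g r = \sum_(r <- R) v g (act h r))%R.
    by rewrite -(perm_big _ (act_perm h Hh)) big_map.
  rewrite -big_split; apply: eq_big_seq => r rR /=.
  have /RP [Hr _] := rR; have aR := actR _ _ Hh rR.
  have eact : act (g * h) r = act g (act h r).
    apply: rep_same; rewrite -mulgA; apply: sameM.
    by exists (v h r); exact: vP.
  apply: (zpow_inj tf f1); apply: (@mulgI _ (act g (act h r))).
  rewrite -{1}eact -(vP _ _ (HM Hg Hh) rR) zpowD mulgA -(vP _ _ Hg aR).
  by rewrite -!mulgA -(vP _ _ Hh rR).
exists theta; split=> //.
have [n n0 nP] : exists2 n, 0 < n & forall r, r \in R -> commute r (f ^+ n).
  have : forall r, r \in R -> H r by move=> r /RP [].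
  elim: R {RP repR uR actR v0 v0P v vP act_perm theta thetaM} => [|r R IH] HR.
    by exists 1%N.
  have [n n0 nP] := IH (fun r' r'R => HR r' (mem_behead (s := r :: R) r'R)).
  have [m m0 mP] := central r (HR r (mem_head _ _)).
  exists (n * m)%N; first by rewrite muln_gt0 n0.
  move=> r'; rewrite inE => /orP [/eqP ->|/nP nr'].
    by rewrite mulnC expgnA; exact: commuteX.
  by rewrite expgnA; exact: commuteX.
have thetaX k : theta (f ^+ k) = (theta f * k%:Z)%R.
  elim: k => [|k IH].
    by have := thetaM 1 1 H1 H1; rewrite mulg1 mulr0 expg0; move: (theta 1); lia.
  rewrite expgS thetaM ?IH //; last exact: (subgroup_zpow (Posz k)).
  lia.
have : theta (f ^+ n) = ((size R)%:Z * n%:Z)%R.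
  rewrite /theta (eq_big_seq (fun=> Posz n)).
    by rewrite big_const_seq count_predT iter_addr_0 -mulr_natl natz.
  move=> r rR; have /RP [_ er] := rR.
  have Hfn : H (f ^+ n) by exact: (subgroup_zpow (Posz n)).
  have eact : act (f ^+ n) r = r.
    by rewrite -{2}er; apply: rep_same; exists (Posz n); rewrite -(nP r rR).
  apply: (zpow_inj tf f1); apply: (@mulgI _ r).
  by rewrite -{1}eact -(vP _ _ Hfn rR) -(nP r rR).
have R0 : 0 < size R by case: (R) (repR 1 H1).
rewrite thetaX => e t0; move: e; rewrite t0 mul0r; nia.
Qed.

End Transfer.

(** * The Frattini subgroup of a finitely generated group *)

Section FrattiniTheory.
Variable G : groupType.

(** By Zorn's lemma: a union of a chain of proper subgroups is proper, since it
    would otherwise contain the finite generating set at some stage. *)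
Lemma exists_maximal_subgroup (S : seq G) (K : set G) :
  generates S -> is_subgroup K -> K != setT ->
  exists2 M, maximal_subgroup M & K `<=` M.
Proof.
move=> genS Kgrp KT.
pose P := [set A : set G | is_subgroup (K `|` A) /\ K `|` A != setT].
(* The ordering is on [A], but the subgroups are the [K `|` A]: the empty chain
   then has an upper bound. *)
have [F FP totF|A [[Agrp AT] Amax]] := @Zorn_bigcup G P.
  (* adding the empty set makes the chain nonempty, so that K need not be
     treated separately in the union *)
  pose F0 := set0 |` F.
  have P0 : P set0 by split; rewrite setU0.
  have F0P X : F0 X -> P X by case=> [->|/FP].
  have pick2 X Y : F0 X -> F0 Y -> exists Z, [/\ F0 Z, X `<=` Z & Y `<=` Z].
    move=> [->|FX] FY; first by exists Y; split.
    case: FY => [->|FY]; first by exists X; split => //; right.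
    have [XY|YX] := totF X Y FX FY.
      by exists Y; split=> //; right.
    by exists X; split=> //; right.
  have UE : K `|` \bigcup_(X in F) X = \bigcup_(X in F0) (K `|` X).
    rewrite eqEsubset; split=> x.
      move=> [Kx|[X FX Xx]]; first by exists set0; [left|left].
      by exists X; [right|right].
    by move=> [X [->|FX] [Kx|Xx]] //; [left|left|right; exists X].
  split; rewrite UE.
    split.
    - by exists set0; [left|left; case: Kgrp].
    - move=> x y [X FX Xx] [Y FY Yy]; have [Z [FZ XZ YZ]] := pick2 X Y FX FY.
      exists Z => //; have [[_ ZM _] _] := F0P Z FZ.
      by apply: ZM; [case: Xx => [|/XZ]|case: Yy => [|/YZ]]; by [left|right].
    - move=> x [X FX Xx]; exists X => //.
      by have [[_ _ XV] _] := F0P X FX; exact: XV.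
  apply/eqP => UT.
  have [X FX SX] : exists2 X, F0 X & forall s, s \in S -> (K `|` X) s.
    elim: (S) => [|s S' [X FX SX]]; first by exists set0; first by left.
    have : (\bigcup_(X in F0) (K `|` X)) s by rewrite UT.
    move=> [Y FY Ys]; have [Z [FZ XZ YZ]] := pick2 X Y FX FY.
    exists Z => // t; rewrite inE => /orP [/eqP ->|/SX].
      by case: Ys => [|/YZ]; by [left|right].
    by case=> [|/XZ]; by [left|right].
  have [Xgrp /eqP XT] := F0P X FX.
  by apply: XT; exact: genS.
exists (K `|` A); last exact: subsetUl.
split=> // H Hgrp HT [sub nsub]; apply: (Amax H).
  split; first by apply: subset_trans sub; exact: subsetUr.
  by move=> HA; apply: nsub => x /HA; right.
have -> : P H = (is_subgroup (K `|` H) /\ K `|` H != setT) by [].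
have -> : K `|` H = H.
  by rewrite setUC; apply/setUidPl; apply: subset_trans sub; exact: subsetUl.
by [].
Qed.

Lemma Frattini_subgroup : is_subgroup (Frattini G).
Proof.
split.
- by move=> M [[]].
- by move=> x y Fx Fy M maxM; have [[_ HM _] _ _] := maxM; apply: HM; [exact: Fx|exact: Fy].
- by move=> x Fx M maxM; have [[_ _ HV] _ _] := maxM; apply: HV; exact: Fx.
Qed.

Lemma conj_subgroup (H : set G) g :
  is_subgroup H -> is_subgroup [set x | H (g * x * g^-1)].
Proof.
move=> [H1 HM HV]; split=> /=.
- by rewrite mulg1 mulgV.
- by move=> x y Hx Hy; have := HM _ _ Hx Hy; rewrite -!mulgA mulKg.
- by move=> x Hx; have := HV _ Hx; rewrite !invgM invgK mulgA.
Qed.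

Lemma conj_proper (H : set G) g :
  H != setT -> [set x | H (g * x * g^-1)] != setT.
Proof.
move=> /eqP HT; apply/eqP => HgT; apply: HT; apply/seteqP; split=> // x _.
have : [set x | H (g * x * g^-1)] (g^-1 * x * g) by rewrite HgT.
by rewrite /= -!mulgA mulVKg mulgV mulg1.
Qed.

Lemma Frattini_normal g x : Frattini G x -> Frattini G (g * x * g^-1).
Proof.
move=> Fx M [Mgrp MT Mmax]; apply: (Fx [set x | M (g * x * g^-1)]).
split; [exact: conj_subgroup|exact: conj_proper|].
move=> H Hgrp HT [sub nsub].
apply: (Mmax [set x | H (g^-1 * x * g^-1^-1)]).
- exact: conj_subgroup.
- exact: conj_proper.
split=> [y My|sub']; first by apply: sub; rewrite /= invgK -!mulgA mulVKg mulgV mulg1.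
apply: nsub => y Hy; apply: sub'; rewrite /= invgK.
by rewrite -!mulgA mulKg mulVg mulg1.
Qed.

Lemma Frattini_nongenerators (S : seq G) (b : nat -> G) (K : set G) :
  generates S -> (forall i, i < size S -> Frattini G (b i)) ->
  is_subgroup K -> (forall i, i < size S -> K (nth 1 S i * b i)) -> K = setT.
Proof.
move=> genS Fb Kgrp Kb; apply: contrapT => /eqP KT.
have [M maxM KM] := exists_maximal_subgroup genS Kgrp KT.
have [[M1 MM MV] /eqP MT _] := maxM; apply: MT; apply: genS => // s sS.
rewrite -(nth_index 1 sS); have := sS; rewrite -index_mem => lt.
rewrite -[X in M X](mulgK (b (index s S))); apply: MM; first exact/KM/Kb.
by apply: MV; exact: Fb.
Qed.

(** Multiplying each generator [s] by [zpow f (m * theta s)], where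
    [m = theta f], turns its value into [theta s * (m * m + 1)]. The new
    elements still generate, so [m * m + 1] divides [m]. *)
Lemma Frattini_to_int (theta : G -> int) (f : G) : finitely_generated G ->
  (forall x y, theta (x * y) = (theta x + theta y)%R) ->
  Frattini G f -> theta f = 0%R.
Proof.
move=> [S genS] thetaM Ff.
have theta1 : theta 1 = 0%R by have := thetaM 1 1; rewrite mulg1; lia.
have thetaV x : theta x^-1 = (- theta x)%R.
  by have := thetaM x x^-1; rewrite mulgV theta1; lia.
have thetaX x k : theta (x ^+ k) = (theta x * k%:Z)%R.
  by elim: k => [|k IH]; rewrite ?theta1 ?mulr0 // expgS thetaM IH; lia.
have thetaZ x z : theta (zpow x z) = (theta x * z)%R.
  by case: z => k; rewrite /= ?thetaV thetaX // NegzE mulrN.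
set m := theta f.
pose K : set G := [set x | exists z : int, theta x = (z * (m * m + 1))%R].
have KT : K = setT.
  pose b i := zpow f (m * theta (nth 1%g S i))%R.
  apply: (@Frattini_nongenerators S b K genS).
  - by move=> i _; exact: subgroup_zpow Frattini_subgroup Ff _.
  - split.
    + by exists 0%R; rewrite mul0r.
    + by move=> x y [z ez] [z' ez']; exists (z + z')%R; rewrite thetaM ez ez' mulrDl.
    + by move=> x [z ez]; exists (- z)%R; rewrite thetaV ez mulNr.
  - move=> i _; exists (theta (nth 1 S i)); rewrite thetaM thetaZ -/m.
    by rewrite mulrDr mulr1 addrC mulrA [(_ * theta _)%R]mulrC.
have [z ez] : K f by rewrite KT.
rewrite -/m in ez *; have [z0|[z0|z0]] : z = 0%R \/ (1 <= z \/ z <= -1)%R by lia.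
- by rewrite ez z0 mul0r.
- nia.
- nia.
Qed.

End FrattiniTheory.

(** * Ping-pong *)

Lemma cover_power (C : groupType) (f k : C) (B : seq C) :
  (forall i, exists2 b, b \in B & exists z, k ^+ i = b * zpow f z) ->
  exists2 n, 0 < n & exists z, k ^+ n = zpow f z.
Proof.
move=> cover; have /choice [b bP] : forall i, exists b, b \in B /\
    exists z, k ^+ i = b * zpow f z.
  by move=> i; have [b bB bz] := cover i; exists b.
have [bB /choice [z kE]] := all_and2 bP.
have [i [j [ij _ e]]] := @pigeonhole_nat _ B b (fun i _ => bB i).
exists (j - i); first by rewrite subn_gt0.
exists (- z i + z j)%R; apply: (@mulgI _ (k ^+ i)).
by rewrite -expgnDr subnKC ?(ltnW ij) // zpowD zpowN !kE e -mulgA mulVKg.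
Qed.

(** [h] commutes with its power [zpow f z], and [z] can vanish only if
    [h = 1]. *)
Lemma commute_root (C : groupType) (f h : C) n z : torsion_free C ->
  0 < n -> h ^+ n = zpow f z -> exists2 m, 0 < m & commute h (f ^+ m).
Proof.
move=> tf n0 e; case: z e => [[|m]|m] e.
- exists 1%N => //; rewrite (tf h n n0 e); exact/commute_sym/commute1.
- by exists m.+1 => //; have <- : h ^+ n = f ^+ m.+1 by []; exact: commuteX.
- exists m.+1 => //; have <- : (h ^+ n)^-1 = f ^+ m.+1 by rewrite e /= invgK.
  by apply: commuteV; exact: commuteX.
Qed.

(** A greedy choice: if [F] is not covered by finitely many left cosets of the
    commensurator, neither is any translate [A i * F]. *)
Lemma scattered_cosets (C : groupType) (f : C) (F : set C) (A : nat -> C) :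
  (forall B : seq C, exists2 k, F k & forall b, b \in B ->
    ~ commensurates f (b^-1 * k)) ->
  forall n, exists c : nat -> C,
    (forall i, i < n -> F ((A i)^-1 * c i)) /\
    (forall i j, i < j < n -> ~ commensurates f ((c i)^-1 * c j)).
Proof.
move=> avoid; elim=> [|n [c [cF cE]]].
  by exists (fun=> 1); split=> // i j /andP [].
have [k Fk kB] := avoid [seq (A n)^-1 * c i | i <- iota 0 n].
exists (fun i => if i == n then A n * k else c i); split.
  move=> i; rewrite ltnS leq_eqVlt; case: eqP => [->|_] /=; last exact: cF.
  by rewrite mulKg.
move=> i j; rewrite ltnS => /andP [ij jn].
have -> : (i == n) = false by lia.
case: eqP => [jE|jN].
  have -> : (c i)^-1 * (A n * k) = ((A n)^-1 * c i)^-1 * k.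
    by rewrite invgM invgK mulgA.
  by apply/kB/map_f; rewrite mem_iota; lia.
by apply: cE; lia.
Qed.

Section PingPong.
Variables (C : groupType) (len : C -> nat) (D : nat).
Hypothesis hyp : hyperbolic_length len D.
Variables (A : eqType) (bar : A -> A) (u : A -> C).

Definition word_value (w : seq A) : C := \prod_(a <- w) u a.

Lemma cancel_or_reduced (w : seq A) :
  sorted (fun a b => b != bar a) w \/
  exists w1 a w2, w = w1 ++ [:: a, bar a & w2].
Proof.
elim: w => [|a [|b w] IH]; [by left|by left|].
have [sw|[w1 [a' [w2 ->]]]] := IH; last by right; exists (a :: w1), a', w2.
by have [->|ne] := eqVneq b (bar a); [right; exists [::], a, w|left; rewrite /= ne].
Qed.

Hypothesis uV : forall a, u (bar a) = (u a)^-1.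

(** The letters [u a] start in pairwise divergent directions, so the path
    spelled by a reduced word has small corners: at each corner meet
    [u (bar a)] and [u b] with [b != bar a]. *)
Lemma ping_pong k M : 0 < M ->
  (forall a b, a != b -> nearly_between len k (u a) 1 (u b)) ->
  (forall a, k + D + M <= len (u a)) ->
  forall w, word_value w = 1 \/ M <= len (word_value w).
Proof.
move=> M0 turn long w; have [n] := ubnP (size w); elim: n w => // n IH w sw.
have [red|[w1 [a [w2 wE]]]] := cancel_or_reduced w; last first.
  have -> : word_value w = word_value (w1 ++ w2).
    by rewrite /word_value wE !big_cat !big_cons uV /= mulVKg.
  by apply: IH; move: sw; rewrite wE !size_cat /=; lia.
case: w red sw => [|a0 w'] red _; first by left; rewrite /word_value big_nil.
right; set w := a0 :: w' in red *.
pose W i := word_value (take i w).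
have WS i : i < size w -> W i.+1 = W i * u (nth a0 w i).
  by move=> iw; rewrite /W (take_nth a0) // /word_value big_rcons.
have [|||_] := @local_to_global _ _ _ hyp W (size w) k M M0 _ _ (size w').
- by move=> i iw; rewrite WS // gdistMr.
- move=> i iw; have iw' := ltnW iw.
  rewrite (WS i.+1) // -[W i](mulgK (u (nth a0 w i))) -(WS i) // -uV.
  rewrite -[X in nearly_between _ _ _ X _]mulg1; apply: nearM; apply: turn.
  rewrite eq_sym; move/sortedP: red => /(_ a0); exact.
- by [].
have -> : W 0 = 1 by rewrite /W take0 /word_value big_nil.
have -> : W (size w').+1 = word_value w.
  by rewrite /W -[(size w').+1]/(size w) take_size.
by rewrite gdist1 mulnS; apply: leq_trans; exact: leq_addr.
Qed.

End PingPong.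

(** * Homomorphisms to torsion-free hyperbolic groups *)

Section FrattiniImage.
Variables (G C : groupType) (len : C -> nat) (D : nat).
Hypothesis hfg : finitely_generated G.
Hypothesis hyp : hyperbolic_length len D.
Hypothesis tf : torsion_free C.
Variable phi : G -> C.
Hypothesis phiM : {morph phi : x y / x * y}.

Let phi1 : phi 1 = 1.
Proof. by apply: (@mulgI _ (phi 1)); rewrite -phiM !mulg1. Qed.

Let phiV : {morph phi : x / x^-1}.
Proof. by move=> x; apply/esym/mulg1_eq; rewrite -phiM mulgV. Qed.

Let phiX n : {morph phi : x / x ^+ n}.
Proof.
by move=> x; elim: n => [|n IH]; rewrite ?expg0 ?phi1 // !expgS phiM IH.
Qed.

Let F := phi @` Frattini G.

(** As finitely many cosets of the commensurator cover [F], so do finitely many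
    cosets of [<phi f>], and every element of [F] has a power in [<phi f>]. For
    the conjugate of [phi f] by [phi g] this says that [phi g] commensurates
    [<phi f>]. So [phi G] is in the commensurator, a finite union of cosets of
    [<phi f>], and the transfer applies. *)
Lemma elementary_case (f : G) (K : nat) (B : seq C) :
  Frattini G f -> phi f <> 1 -> quasi_axis len K (phi f) ->
  (forall k, F k -> exists2 b, b \in B & commensurates (phi f) (b^-1 * k)) ->
  False.
Proof.
move=> Ff f1 axis coverF.
have [FG1 FGM _] := Frattini_subgroup G.
have [B' coverE] := commensurator_cover hyp tf f1 axis.
have commE (g : G) : commensurates (phi f) (phi g).
  have [|n n0 [z e]] := @cover_power _ (phi f) (phi (g * f * g^-1))
      [seq b * b' | b <- B, b' <- B'] _.
    move=> i; have Fk : F (phi (g * f * g^-1) ^+ i).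
      exists ((g * f * g^-1) ^+ i); last by rewrite phiX.
      exact: (subgroup_zpow (Frattini_subgroup G) (Frattini_normal g Ff) (Posz i)).
    have [b bB /coverE [b' bB' [z e]]] := coverF _ Fk.
    exists (b * b'); first by apply/allpairsP; exists (b, b').
    by exists z; rewrite -[RHS]mulgA -e mulVKg.
  exists (Posz n), z; split; first by lia.
  rewrite -e !phiM phiV -[_ ^+ n]/(zpow _ (Posz n)) -zpow_conj mulgVK //.
have cover (g : G) : exists2 b, b \in B' & exists z, phi g = b * zpow (phi f) z.
  exact: coverE.
have [| | | |theta [thetaM thetaf]] := @transfer C (range phi) (phi f) tf f1 _ _ B' _ _.
- split; first by exists 1; rewrite ?phi1.
  + by move=> _ _ [x _ <-] [y _ <-]; exists (x * y); rewrite ?phiM.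
  + by move=> _ [x _ <-]; exists x^-1; rewrite ?phiV.
- by exists f.
- by move=> _ [g _ <-].
- move=> _ [g _ <-]; have [|n n0 [z e]] := @cover_power _ (phi f) (phi g) B'.
    by move=> i; rewrite -phiX.
  exact: commute_root tf n0 e.
apply: thetaf; apply: (@Frattini_to_int G (fun x => theta (phi x)) f hfg) => //.
by move=> x y; rewrite phiM thetaM.
Qed.

(** A letter [(i, b)] stands for [u_i] or, if [b] is true, for its inverse.
    The elements [c i.*2] and [c i.*2.+1] are the [alpha_i] and [beta_i] with
    [u_i = alpha_i * phi f ^+ n * beta_i^-1], so that a letter [l] starts along
    the translate by [g l] of one of the two rays of the axis. The bounds on
    overlaps do not depend on [n], which can then be chosen as large as
    [ping_pong] requires. *)
Lemma general_case (f : G) (K : nat) :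
  Frattini G f -> phi f <> 1 -> quasi_axis len K (phi f) ->
  (forall B : seq C, exists2 k, F k & forall b, b \in B ->
    ~ commensurates (phi f) (b^-1 * k)) ->
  False.
Proof.
move=> Ff f1 axis avoid; have [S genS] := hfg.
have [FG1 FGM FGV] := Frattini_subgroup G.
set r := size S.
pose a i := if odd i then 1 else phi (nth 1 S i./2).
have [c [cF cE]] := scattered_cosets a avoid r.*2.
pose A := ('I_r * bool)%type.
pose e (l : A) := l.2 + (val l.1).*2.
have elt l : e l < r.*2 by case: l => [[i lt] b]; rewrite /e /=; case: b; lia.
have einj : injective e.
  move=> [[i lt] b] [[i' lt'] b']; rewrite /e /= => ee.
  have bb : b = b' by case: b b' ee => [] []; lia.
  by congr (_, _) => //; apply: val_inj => /=; move: ee; rewrite bb; lia.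
pose g (l : A) := c (e l).
have gE l l' : l != l' -> ~ commensurates (phi f) ((g l)^-1 * g l').
  move=> ne; have : e l != e l' by rewrite (inj_eq einj).
  rewrite neq_ltn => /orP [lt|lt]; first by apply: cE; rewrite lt elt.
  move=> /(commensuratesV tf f1); rewrite invgM invgK; apply: cE.
  by rewrite lt elt.
pose s b n := spow b (phi f) n.
have /choice [T TP] : forall p : A * A, exists T, p.1 != p.2 -> forall n,
    nearly_between len T (s p.1.2 n) 1 ((g p.1)^-1 * g p.2 * s p.2.2 n).
  move=> [l l'] /=; have [_|ne] := eqVneq l l'; first by exists 0.
  by have [T TP] := bounded_overlap hyp tf f1 axis l.2 l'.2 (gE _ _ ne); exists T.
pose T0 := \max_p T p.
pose L := \max_l len (g l).
have gL l : len (g l) <= L by exact: (leq_bigmax l).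
pose k := T0 + 6 * L.
pose M := (len (phi f)).+1.
pose n := 2 * L + k + D + M.
pose bar (l : A) : A := (l.1, ~~ l.2).
pose u l := g l * s l.2 n * (g (bar l))^-1.
have barK : involutive bar by move=> [i b]; rewrite /bar /= negbK.
have uV l : u (bar l) = (u l)^-1.
  rewrite /u barK !invgM invgK mulgA; congr (_ * _ * _).
  by rewrite /s /spow /=; case: l.2; rewrite ?invgK.
have turn l l' : l != l' -> nearly_between len k (u l) 1 (u l').
  move=> ne; have := TP (l, l') ne n => /(nearM (g l)).
  rewrite /= mulg1 -!mulgA mulVKg => h.
  have lT : T (l, l') <= T0 by exact: (leq_bigmax (l, l')).
  have du l1 : gdist len (g l1 * s l1.2 n) (u l1) <= L.
    by rewrite /u gdistMr (lengthV hyp).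
  have d1 : gdist len (g l) 1 <= L by rewrite (gdistC hyp) gdist1.
  apply: near_leq (near_perturb hyp h (du l) d1 (du l')).
  by rewrite leq_add2r.
have long l : k + D + M <= len (u l).
  have le_n : n <= len (s l.2 n).
    apply: leq_trans (axis.2 n) _.
    by rewrite /s /spow; case: l.2; rewrite ?(lengthV hyp).
  have -> : k + D + M = n - L - L by rewrite /n; lia.
  have sE : s l.2 n = (g l)^-1 * (u l * g (bar l)) by rewrite /u mulgVK mulKg.
  have := lengthM hyp (g l)^-1 (u l * g (bar l)); rewrite -sE (lengthV hyp).
  have := lengthM hyp (u l) (g (bar l)).
  by have := gL l; have := gL (bar l); lia.
pose K0 : set G := [set x | exists w : seq A, phi x = word_value u w].
have KT : K0 = setT.
  have /choice [b bP] : forall i, exists b : G, i < r -> Frattini G b /\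
      phi b = (phi (nth 1 S i))^-1 * (c i.*2 * phi f ^+ n * (c i.*2.+1)^-1).
    move=> i; case: (leqP r i) => [_|ir]; first by exists 1.
    have [b0 Fb0 b0E] := cF i.*2 (elt (Ordinal ir, false)).
    have [b1 Fb1 b1E] := cF i.*2.+1 (elt (Ordinal ir, true)).
    rewrite /a odd_double doubleK in b0E; rewrite /a /= odd_double invg1 mul1g in b1E.
    exists (b0 * f ^+ n * b1^-1); split.
      apply: (FGM); last exact: FGV; apply: FGM => //.
      exact: (subgroup_zpow (Frattini_subgroup G) Ff (Posz n)).
    by rewrite !phiM phiV phiX b0E b1E !mulgA.
  apply: (@Frattini_nongenerators G S b K0 genS).
  - by move=> i ir; have [] := bP i ir.
  - split.
    + by exists [::]; rewrite /word_value big_nil phi1.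
    + move=> x y [w xw] [w' yw]; exists (w ++ w').
      by rewrite phiM xw yw /word_value big_cat.
    + move=> x [w xw]; exists (rev (map bar w)); rewrite phiV xw /word_value.
      elim: w {xw} => [|l w IH]; first by rewrite !big_nil invg1.
      by rewrite map_cons rev_cons big_rcons /= big_cons invgM IH uV.
  - move=> i ir; exists [:: (Ordinal ir, false)].
    have [_ bE] := bP i ir.
    by rewrite phiM bE mulVKg /word_value big_seq1 /u /g /e /= add0n add1n.
have [w wE] : K0 f by rewrite KT.
have [|] := @ping_pong _ _ _ hyp _ bar u uV k M isT turn long w; rewrite -wE //.
by rewrite /M ltnn.
Qed.

Theorem Frattini_in_kernel (x : G) : Frattini G x -> phi x = 1.
Proof.
move=> Fx; apply: contrapT => x1.
have [N [K [N0 axis]]] := exists_quasi_axis hyp tf x1.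
rewrite -phiX in axis.
have Ff : Frattini G (x ^+ N).
  exact: (subgroup_zpow (Frattini_subgroup G) Fx (Posz N)).
have f1 : phi (x ^+ N) <> 1 by rewrite phiX => /(tf N0).
case: (pselect (forall B : seq C, exists2 k, F k & forall b, b \in B ->
    ~ commensurates (phi (x ^+ N)) (b^-1 * k))).
  exact: general_case Ff f1 axis.
move=> /existsNP [B cov]; apply: (elementary_case Ff f1 axis (B := B)).
move=> k Fk; apply: contrapT => no; apply: cov; exists k => // b bB com.
by apply: no; exists b.
Qed.

End FrattiniImage.

(** * Word length and thin triangles of vertex paths *)

Section WordLength.
Variables (C : groupType) (S : seq C).
Hypothesis genS : generates S.

Definition letter (c : C) : bool := (c \in S) || (c^-1 \in S).

Definition spelled (x : C) (n : nat) : Prop :=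
  exists w : seq C, [/\ all letter w, size w = n & x = \prod_(c <- w) c].

Lemma spelled1 : spelled 1 0.
Proof. by exists [::]; rewrite big_nil. Qed.

Lemma spelledM x y m n : spelled x m -> spelled y n -> spelled (x * y) (m + n).
Proof.
move=> [w [aw <- ->]] [w' [aw' <- ->]]; exists (w ++ w').
by rewrite all_cat aw aw' size_cat big_cat.
Qed.

Lemma letterV c : letter c -> letter c^-1.
Proof. by rewrite /letter invgK orbC. Qed.

Lemma spelled_letter c : letter c -> spelled c 1.
Proof. by move=> lc; exists [:: c]; rewrite /= lc big_seq1. Qed.

Lemma spelledV x n : spelled x n -> spelled x^-1 n.
Proof.
move=> [w [aw <- ->]] {n x}; elim: w aw => [|c w IH] /=.
  by rewrite big_nil invg1 => _; exact: spelled1.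
move=> /andP [lc /IH sw]; rewrite big_cons invgM -addn1.
by apply: spelledM => //; apply/spelled_letter/letterV.
Qed.

Lemma spelled_exists x : exists n, spelled x n.
Proof.
have KT : [set x | exists n, spelled x n] = setT.
  apply: genS => [|s sS]; last by exists 1%N; apply: spelled_letter; rewrite /letter sS.
  split.
  - by exists 0; exact: spelled1.
  - by move=> y z [m ym] [n zn]; exists (m + n); exact: spelledM.
  - by move=> y [m ym]; exists m; exact: spelledV.
by have : [set x | exists n, spelled x n] x by rewrite KT.
Qed.

Let spelledb x n := `[< spelled x n >].

Let spelledb_exists x : exists n, spelledb x n.
Proof. by have [n xn] := spelled_exists x; exists n; apply/asboolP. Qed.

Definition word_length (x : C) : nat := ex_minn (spelledb_exists x).

Lemma word_length_spelled x : spelled x (word_length x).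
Proof. by rewrite /word_length; case: ex_minnP => m /asboolP. Qed.

Lemma word_length_min x n : spelled x n -> word_length x <= n.
Proof.
move=> xn; rewrite /word_length; case: ex_minnP => m _; apply.
exact/asboolP.
Qed.

Lemma word_length1 : word_length 1 = 0.
Proof. by apply/eqP; rewrite -leqn0; exact/word_length_min/spelled1. Qed.

Lemma word_lengthV x : word_length x^-1 = word_length x.
Proof.
have le y : word_length y^-1 <= word_length y.
  exact/word_length_min/spelledV/word_length_spelled.
by apply/eqP; rewrite eqn_leq le -{1}[x]invgK le.
Qed.

Lemma word_lengthM x y : word_length (x * y) <= word_length x + word_length y.
Proof. by apply/word_length_min/spelledM; exact: word_length_spelled. Qed.

Lemma word_length_ball r : exists B : seq C, forall x, word_length x <= r -> x \in B.
Proof.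
have [B BP] : exists B : seq C, forall x n, spelled x n -> n <= r -> x \in B.
  elim: r => [|r [B BP]].
    exists [:: 1] => x n [w [_ <- ->]]; rewrite leqn0 => /nilP ->.
    by rewrite big_nil mem_head.
  exists (B ++ [seq c * x | c <- S ++ [seq s^-1 | s <- S], x <- B]) => x n.
  move=> [[|c w] [/= aw <- ->]] sw; rewrite mem_cat.
    by rewrite (BP _ 0) //; exists [::].
  have /andP [lc aw'] := aw; apply/orP; right; rewrite big_cons.
  apply/allpairsP; exists (c, \prod_(c <- w) c); split=> //=.
    rewrite mem_cat; have /orP [->//|cS] := lc; apply/orP; right.
    by apply/mapP; exists c^-1; rewrite ?invgK.
  by apply: (BP _ (size w)) => //; exists w.
by exists B => x; apply: BP; exact: word_length_spelled.
Qed.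

Lemma word_length_geodesic x i : i <= word_length x ->
  exists2 m, word_length m = i & word_length (m^-1 * x) = word_length x - i.
Proof.
have [w [aw sw xE]] := word_length_spelled x => ile.
rewrite -(cat_take_drop i w) all_cat in aw; have /andP [at_ ad] := aw.
set m := \prod_(c <- take i w) c; set y := \prod_(c <- drop i w) c.
have xmy : x = m * y by rewrite xE -{1}(cat_take_drop i w) big_cat.
have lm : word_length m <= i.
  by apply: word_length_min; exists (take i w); rewrite at_ size_takel // sw.
have ly : word_length y <= word_length x - i.
  by apply: word_length_min; exists (drop i w); rewrite ad size_drop sw.
have := word_lengthM m y; rewrite -xmy => lxy.
by exists m; [|rewrite xmy mulKg -xmy]; lia.
Qed.

Lemma word_length_function : length_function word_length.
Proof. split; [exact: word_length1|exact: word_lengthV|exact: word_lengthM]. Qed.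

Local Notation d := (gdist word_length).
Let dC := gdistC word_length_function.
Let d_triangle := gdist_triangle word_length_function.
Let dxx := gdistxx word_length_function.

(** The vertices of a geodesic edge path from [x] to [y]. *)
Definition geodesic_path (x y : C) (a : nat -> C) : Prop :=
  [/\ a 0 = x, a (d x y) = y,
      forall i, i < d x y -> letter ((a i)^-1 * a i.+1)
    & forall i, i <= d x y -> d x (a i) = i /\ d (a i) y = d x y - i].

Lemma geodesic_path_exists x y : exists a, geodesic_path x y a.
Proof.
have [w [aw sw xE]] := word_length_spelled (x^-1 * y).
have dxy : d x y = size w by [].
pose a i := x * \prod_(c <- take i w) c.
have aS i : i < size w -> a i.+1 = a i * nth 1 w i.
  by move=> iw; rewrite /a (take_nth 1) // big_rcons mulgA.
have a0 : a 0 = x by rewrite /a take0 big_nil mulg1.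
have an : a (size w) = y by rewrite /a take_size -xE mulVKg.
have step i : i < size w -> letter ((a i)^-1 * a i.+1).
  by move=> iw; rewrite aS // mulKg; exact: (all_nthP _ aw).
have up i : i <= size w -> d x (a i) <= i.
  elim: i => [|i IH] iw; first by rewrite a0 dxx.
  apply: leq_trans (d_triangle x (a i) _) _; rewrite -[X in _ <= X]addn1.
  by apply: leq_add; [exact/IH/ltnW|apply: word_length_min; apply: spelled_letter; exact: step].
have down i : i <= size w -> d (a (size w - i)) y <= i.
  elim: i => [|i IH] iw; first by rewrite subn0 an dxx.
  apply: leq_trans (d_triangle _ (a (size w - i)) _) _; rewrite -[X in _ <= X]add1n.
  apply: leq_add; last exact/IH/ltnW.
  have -> : size w - i = (size w - i.+1).+1 by lia.
  by apply: word_length_min; apply: spelled_letter; apply: step; lia.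
exists a; split; rewrite ?dxy // => i iw.
have := up i iw; have := down _ (leq_subr i (size w)); rewrite subKn //.
have := d_triangle x (a i) y; rewrite dxy; lia.
Qed.

(** Thin triangles for the vertices alone. By symmetry it is enough to consider
    one side of the triangle. *)
Definition thin_paths (e : nat) : Prop :=
  forall x y z a b c, geodesic_path x y a -> geodesic_path y z b ->
  geodesic_path z x c -> forall i, i <= d x y ->
  (exists2 j, j <= d y z & d (a i) (b j) <= e) \/
  (exists2 j, j <= d z x & d (a i) (c j) <= e).

(** A side of a triangle comes as near to the opposite vertex [w] as the Gromov
    product at [w] predicts. The beginning of the side is near [c], its end is
    near [b], so some point is near both, and distances to [w] measured through
    it are almost additive. *)
Lemma thin_paths_near_side e x y w a : thin_paths e -> geodesic_path x y a ->
  exists2 i, i <= d x y &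
    2 * d w (a i) + d x y <= d x w + d w y + 4 * e + 2.
Proof.
move=> thin ga.
have [b gb] := geodesic_path_exists y w; have [c gc] := geodesic_path_exists w x.
have [a0 an al ad] := ga; have [b0 bn bl bd] := gb; have [c0 cn cl cd] := gc.
pose nb i := exists2 j, j <= d y w & d (a i) (b j) <= e.
pose nc i := exists2 j, j <= d w x & d (a i) (c j) <= e.
have [i [ixy nci [i' [ii' ixy' nbi]]]] : exists i, [/\ i <= d x y, nc i &
    exists i', [/\ i' = i \/ i' = i.+1, i' <= d x y & nb i']].
  case: (pselect (exists2 i, i < d x y & nc i /\ ~ nc i.+1)).
    move=> [i ilt [nci nnc]]; exists i; split=> //; first exact: ltnW.
    exists i.+1; split=> //; first by right.
    by have [] := thin _ _ _ _ _ _ ga gb gc i.+1 ilt.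
  move=> nsw; have all_nc i : i <= d x y -> nc i.
    elim: i => [|i IH] ile; first by exists (d w x); rewrite ?a0 ?cn ?dxx.
    apply: contrapT => no; apply: nsw; exists i => //; split=> //.
    by apply: IH; exact: ltnW.
  exists (d x y); split=> //; first exact: all_nc.
  by exists (d x y); split=> //; [left|exists 0; rewrite // b0 an dxx].
exists i => //.
have [j jle dj] := nci; have [j' jle' dj'] := nbi.
have [ci1 ci2] := cd _ jle; have [bi1 bi2] := bd _ jle'.
have [ai1 ai2] := ad _ ixy; have [ai1' ai2'] := ad _ ixy'.
have step : d (a i) (a i') <= 1.
  case: ii' => ii'; rewrite ii' ?dxx // in ixy' *.
  by apply: word_length_min; apply: spelled_letter; apply: al.
have := d_triangle w (c j) (a i); have := d_triangle w (b j') (a i).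
have := d_triangle (a i) (a i') (b j'); have := d_triangle x (c j) (a i).
have := d_triangle (a i) (b j') y.
rewrite [d w x]dC in ci1 ci2 jle; rewrite [d y w]dC in bi1 bi2 jle'.
rewrite [d (c j) x]dC in ci2; rewrite [d (b j') w]dC in bi2.
rewrite [d (c j) (a i)]dC [d (b j') (a i)]dC [d (b j') y]dC.
lia.
Qed.

(** The point of the side [x z] closest to [w] is close to another side, and a
    side can never come nearer to [w] than the Gromov product of its ends. *)
Lemma thin_paths_four_point e : thin_paths e -> hyperbolic_length word_length (6 * e + 2).
Proof.
move=> thin; split.
- exact: word_length_function.
- exact: word_length_ball.
- exact: word_length_geodesic.
move=> x y z w.
have [a ga] := geodesic_path_exists x z.
have [b gb] := geodesic_path_exists z y; have [c gc] := geodesic_path_exists y x.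
have [i ile hi] := thin_paths_near_side w thin ga.
have [b0 bn _ bd] := gb; have [c0 cn _ cd] := gc.
have [[j jle dj]|[j jle dj]] := thin _ _ _ _ _ _ ga gb gc i ile.
- have [bi1 bi2] := bd _ jle.
  have := d_triangle w (a i) (b j); have := d_triangle w (b j) z.
  have := d_triangle w (b j) y; rewrite [d (b j) z]dC.
  rewrite [d z w]dC [d y z]dC [d y w]dC; move: bi1 bi2 hi dj jle; lia.
- have [ci1 ci2] := cd _ jle.
  have := d_triangle w (a i) (c j); have := d_triangle w (c j) x.
  have := d_triangle w (c j) y; rewrite [d (c j) y]dC.
  rewrite [d y w]dC [d x y]dC [d z w]dC; rewrite [d x w]dC in hi *.
  move: ci1 ci2 hi dj jle; lia.
Qed.

End WordLength.

(** * From the Cayley graph to the word metric *)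

Section CayleyMetric.
Local Open Scope ring_scope.
Variables (R : realType) (C : groupType) (S : seq C).
Hypothesis genS : generates S.
Local Notation len := (word_length genS).
Local Notation d := (gdist len).
Local Notation point := (@cayley_point R C S).
Local Notation vertex := (@Vertex R C S).
Local Notation cdist := (@cayley_dist R C S).

Let dC := gdistC (word_length_function genS).
Let d_triangle := gdist_triangle (word_length_function genS).

(** The distance in the Cayley graph from the vertex [v] to [p], computed from
    the word metric. It is what bounds [cayley_dist], an infimum, from below. *)
Definition vdist (v : C) (p : point) : R :=
  match p with
  | Vertex g => (d v g)%:R
  | EdgePoint g s t _ _ =>
      Num.min ((d v g)%:R + t) ((d v (g * s)%g)%:R + (1 - t))
  end.

Lemma edge_path_length (x y : C) (w : seq C) :
  edge_path S x w y -> (d x y <= size w)%N.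
Proof.
move=> [aw ->]; apply: word_length_min; exists w; split=> //.
by rewrite monoid.mulKg.
Qed.

Lemma edge_path_geodesic (x y : C) : exists2 w, edge_path S x w y & size w = d x y.
Proof.
have [w [aw sw xE]] := word_length_spelled genS (x^-1 * y)%g.
by exists w => //; split=> //; rewrite -xE monoid.mulVKg.
Qed.

Lemma d_letter v g s : s \in S ->
  (d v g <= (d v (g * s)%g).+1)%N /\ (d v (g * s)%g <= (d v g).+1)%N.
Proof.
move=> sS; have l1 : (d g (g * s)%g <= 1)%N.
  rewrite /gdist monoid.mulKg; apply: word_length_min; apply: spelled_letter.
  by rewrite /letter sS.
have := d_triangle v g (g * s)%g; have := d_triangle v (g * s)%g g.
by rewrite [d (g * s)%g g]dC; lia.
Qed.

Lemma vdist_arc v p x a : arc_to_vertex p x a ->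
  vdist v p <= (d v x)%:R + a /\ (d v x)%:R <= vdist v p + a.
Proof.
case: p => [g|g s t sS t01] /=; first by move=> [-> ->]; lra.
have [le1 le2] := d_letter v g sS.
have {}le1 : (d v g)%:R <= (d v (g * s)%g)%:R + 1 :> R.
  by rewrite natr1 ler_nat.
have {}le2 : (d v (g * s)%g)%:R <= (d v g)%:R + 1 :> R.
  by rewrite natr1 ler_nat.
have /andP [t0 t1] := t01.
by case=> [[-> ->]|[-> ->]]; case: (leP ((d v g)%:R + t)); lra.
Qed.

Lemma arc_ge0 (p : point) x a : arc_to_vertex p x a -> 0 <= a.
Proof.
case: p => [g|g s t sS /andP [t0 t1]] /=; first by move=> [_ ->].
by case=> [[_ ->]|[_ ->]]; lra.
Qed.

(** Along a path, the distance from [v] changes by at most the length. *)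
Lemma vdist_lipschitz v (p q : point) l : path_length p q l ->
  0 <= l /\ `|vdist v p - vdist v q| <= l.
Proof.
case=> [|[x [y [a [b [w [px qy xy ->]]]]]]].
  case: p q => [//|g s t sS /andP [t0 t1]] [//|h u t' uS /andP [t0' t1']] /= [-> -> ->].
  split; first exact: normr_ge0.
  have n1 := ler_norm (t - t'); have n2 := ler_norm (t' - t); rewrite distrC in n2.
  rewrite ler_norml; apply/andP.
  by case: (leP ((d v h)%:R + t)); case: (leP ((d v h)%:R + t')); split; lra.
have [p1 p2] := vdist_arc v px; have [q1 q2] := vdist_arc v qy.
have a0 := arc_ge0 px; have b0 := arc_ge0 qy.
have xyl := edge_path_length xy.
have t1 : (d v x)%:R <= (d v y)%:R + (size w)%:R :> R.
  rewrite -natrD ler_nat; apply: leq_trans (d_triangle v y x) _.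
  by rewrite leq_add2l dC.
have t2 : (d v y)%:R <= (d v x)%:R + (size w)%:R :> R.
  rewrite -natrD ler_nat; apply: leq_trans (d_triangle v x y) _.
  by rewrite leq_add2l.
have w0 := ler0n R (size w).
by split; [lra|rewrite ler_norml; apply/andP; split; lra].
Qed.

Lemma path_length_vertices (p q : point) x y a b :
  arc_to_vertex p x a -> arc_to_vertex q y b ->
  path_length p q (a + (d x y)%:R + b).
Proof.
move=> px qy; have [w wp ws] := edge_path_geodesic x y.
by right; exists x, y, a, b, w; split; rewrite ?ws.
Qed.

Lemma arc_exists (p : point) : exists x a, arc_to_vertex p x a.
Proof.
by case: p => [g|g s t sS t01]; [exists g, 0|exists g, t; left].
Qed.

Lemma cayley_dist_le (p q : point) l : path_length p q l -> cdist p q <= l.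
Proof.
move=> pl; apply: ge_inf => //; exists 0 => l' /(vdist_lipschitz 1%g).
by case.
Qed.

Lemma vdist_le_cayley v (p q : point) : `|vdist v p - vdist v q| <= cdist p q.
Proof.
apply: lb_le_inf.
  have [x [a px]] := arc_exists p; have [y [b qy]] := arc_exists q.
  by eexists; exact: path_length_vertices px qy.
by move=> l /(vdist_lipschitz v) [].
Qed.

(** If [g^-1 * h] is the inverse of an element of [S], the edge between [g] and
    [h] is given by [EdgePoint] starting at [h], so its parameter is
    reversed. *)
Lemma edge_parametrization (g h : C) : letter S (g^-1 * h)%g ->
  exists e : R -> point, forall t : R, 0 < t < 1 ->
    [/\ arc_to_vertex (e t) g t, arc_to_vertex (e t) h (1 - t),
      forall v, vdist v (e t) = Num.min ((d v g)%:R + t) ((d v h)%:R + (1 - t))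
    & forall t' : R, 0 < t' < 1 -> path_length (e t) (e t') `|t - t'|].
Proof.
set c := (g^-1 * h)%g; have hE : h = (g * c)%g by rewrite monoid.mulVKg.
case/orP=> cS.
  exists (fun t => if pselect (0 < t < 1) is left h then EdgePoint g cS h else vertex g).
  move=> t t01; case: pselect => // t01'; split=> /=; [by left|by right|by move=> v; rewrite hE|].
  by move=> t' t01''; case: pselect => // ?; left.
have gE : g = (h * c^-1)%g by rewrite hE monoid.mulgK.
have opp (t : R) : 0 < t < 1 -> 0 < 1 - t < 1 by move=> /andP [? ?]; lra.
exists (fun t => if pselect (0 < 1 - t < 1) is left h' then EdgePoint h cS h' else vertex g).
move=> t /opp t01; case: pselect => // t01'; split=> /=.
- by right; rewrite -gE; split=> //; lra.
- by left.
- by move=> v; rewrite -gE minC; congr (Num.min _ _); lra.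
- move=> t' /opp t01''; case: pselect => // ?; left; split=> //.
  by rewrite -normrN; congr `|_|; lra.
Qed.

Lemma geodesic_path_dist (x y : C) a i j : geodesic_path genS x y a ->
  (i <= j <= d x y)%N -> (d (a i) (a j) <= j - i)%N.
Proof.
move=> [_ _ al _] /andP [ij jn]; elim: j ij jn => [|j IH].
  by rewrite leqn0 => /eqP -> _; rewrite /gdist monoid.mulVg word_length1.
rewrite leq_eqVlt => /orP [/eqP -> _|ij jn].
  by rewrite /gdist monoid.mulVg word_length1.
apply: leq_trans (d_triangle _ (a j) _) _; rewrite subSn //.
rewrite -[X in (_ <= X)%N]addn1; apply: leq_add; first by apply: IH => //; exact: ltnW.
by apply: word_length_min; apply: spelled_letter; exact: al.
Qed.

(** A geodesic edge path becomes a geodesic of the Cayley graph by joining its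
    vertices along edges. The path gives the upper bound on distances between
    its points; the lower bound holds as [vdist x] increases at unit speed. The
    last clause allows points of the segment to be replaced by vertices. *)
Lemma geodesic_path_segment (x y : C) a : geodesic_path genS x y a ->
  exists A : set point, [/\ geodesic_segment cdist (vertex x) (vertex y) A,
    forall k, (k <= d x y)%N -> A (vertex (a k))
  & forall p, A p -> exists2 k, (k <= d x y)%N &
      forall v, (d v (a k))%:R <= vdist v p + 1].
Proof.
move=> ga; set n := d x y; have [a0 an al ad] := ga.
have /choice [e eP] : forall k, exists e : R -> point, (k < n)%N ->
    forall t : R, 0 < t < 1 ->
    [/\ arc_to_vertex (e t) (a k) t, arc_to_vertex (e t) (a k.+1) (1 - t),
      forall v, vdist v (e t) = Num.min ((d v (a k))%:R + t) ((d v (a k.+1))%:R + (1 - t))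
    & forall t' : R, 0 < t' < 1 -> path_length (e t) (e t') `|t - t'|].
  move=> k; case: (pselect (k < n)%N) => [kn|nkn]; last by exists (fun=> vertex x).
  by have [e eP] := edge_parametrization (al k kn); exists e.
pose gamma (t : R) : point := let k := Num.truncn t in
  if t == k%:R then vertex (a k) else e k (t - k%:R).
have gamma_nat k : gamma k%:R = vertex (a k).
  by rewrite /gamma natrK eqxx.
have gammaP (t : R) : 0 <= t <= n%:R -> (exists2 k, (k <= n)%N & t = k%:R) \/
    (exists k (s : R), [/\ (k < n)%N, 0 < s < 1, t = k%:R + s & gamma t = e k s]).
  move=> /andP [t0 tn]; have /andP [k1 k2] := truncn_itv t0.
  rewrite /gamma; set k := Num.truncn t in k1 k2 *; case: eqP => [tk|tk].
    by left; exists k => //; rewrite -(ler_nat R) -tk.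
  right; exists k, (t - k%:R); rewrite -natr1 in k2.
  have kt : k%:R < t by rewrite lt_neqAle k1 andbT eq_sym; exact/eqP.
  split=> //; [|by apply/andP; split; lra|lra].
  by rewrite -(ltr_nat R); lra.
have up (t : R) : 0 <= t <= n%:R -> exists k, [/\ (k <= n)%N, t <= k%:R < t + 1 &
    arc_to_vertex (gamma t) (a k) (k%:R - t)].
  move=> /gammaP [[k kn ->]|[k [s [kn s01 -> ->]]]].
    exists k; rewrite gamma_nat /= subrr lexx; split=> //.
    by rewrite /= ltrDl.
  have [_ h _ _] := eP k kn s s01; have /andP [s0 s1] := s01.
  exists k.+1; rewrite -natr1; split=> //; first by apply/andP; split; lra.
  by have -> : k%:R + 1 - (k%:R + s) = 1 - s by lra.
have down (t : R) : 0 <= t <= n%:R -> exists k, [/\ (k <= n)%N, k%:R <= t < k%:R + 1 &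
    arc_to_vertex (gamma t) (a k) (t - k%:R)].
  move=> /gammaP [[k kn ->]|[k [s [kn s01 -> ->]]]].
    exists k; rewrite gamma_nat /= subrr lexx; split=> //.
    by rewrite /= ltrDl.
  have [h _ _ _] := eP k kn s s01; have /andP [s0 s1] := s01.
  exists k; split; [exact: ltnW|by apply/andP; split; lra|].
  by have -> : k%:R + s - k%:R = s by lra.
have vg (t : R) : 0 <= t <= n%:R -> vdist x (gamma t) = t.
  move=> /gammaP [[k kn ->]|[k [s [kn s01 -> ->]]]].
    by rewrite gamma_nat /=; have [-> _] := ad k kn.
  have [_ _ -> _] := eP k kn s s01.
  have [-> _] := ad k (ltnW kn); have [-> _] := ad k.+1 kn.
  by have /andP [s0 s1] := s01; rewrite -natr1; case: leP; lra.
have short (t t' : R) : 0 <= t <= n%:R -> 0 <= t' <= n%:R -> t <= t' ->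
    path_length (gamma t) (gamma t') `|t - t'| /\ path_length (gamma t') (gamma t) `|t' - t|.
  move=> t0 t'0 tt'.
  have [k [kn /andP [k1 k2] karc]] := up t t0.
  have [k' [kn' /andP [k1' k2'] karc']] := down t' t'0.
  rewrite [`|t' - t|]distrC.
  case: (leqP k k') => [kk'|k'k].
    have le1 : (d (a k) (a k'))%:R <= k'%:R - k%:R :> R.
      by rewrite -natrB // ler_nat; apply: (geodesic_path_dist ga); rewrite kk'.
    have p1 := path_length_vertices karc karc'.
    have p2 := path_length_vertices karc' karc; rewrite [d (a k') _]dC in p2.
    have [_ ge1] := vdist_lipschitz x p1; rewrite !vg // in ge1.
    suff E : `|t - t'| = k%:R - t + (d (a k) (a k'))%:R + (t' - k'%:R).
      split; first by rewrite E.
      have -> : `|t - t'| = t' - k'%:R + (d (a k) (a k'))%:R + (k%:R - t) by lra.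
      exact: p2.
    have n1 := ler_norm (t' - t); rewrite distrC in n1.
    by apply/eqP; rewrite eq_le ge1 /=; lra.
  (* both points lie inside one and the same edge *)
  have kS : k%:R = k'%:R + 1 :> R.
    have : k'.+1%:R <= k%:R :> R by rewrite ler_nat.
    have : (k < k'.+2)%N by rewrite -(ltr_nat R) -!natr1; lra.
    move=> lt2 le1; have -> : k = k'.+1 by lia.
    by rewrite natr1.
  have inside (s : R) : k'%:R < s -> s < k'%:R + 1 -> s <= n%:R ->
      (k' < n)%N /\ 0 < s - k'%:R < 1 /\ gamma s = e k' (s - k'%:R).
    move=> s1 s2 sn; have sk : Num.truncn s = k'.
      by apply: truncn_def; rewrite -natr1 s2 ltW.
    split; first by rewrite -(ltr_nat R); lra.
    split; first by apply/andP; split; lra.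
    by rewrite /gamma sk ifF //; apply/eqP; lra.
  have /andP [_ tn] := t0; have /andP [_ tn'] := t'0.
  have [||| k'n [s01 ->]] := inside t; [lra|lra|lra|].
  have [||| _ [s01' ->]] := inside t'; [lra|lra|lra|].
  have [_ _ _ h] := eP _ k'n _ s01; have [_ _ _ h'] := eP _ k'n _ s01'.
  have := h _ s01'; have := h' _ s01.
  have -> : t' - k'%:R - (t - k'%:R) = t' - t by lra.
  have -> : t - k'%:R - (t' - k'%:R) = t - t' by lra.
  by rewrite [`|t' - t|]distrC.
exists (gamma @` [set` `[0, n%:R]]); split.
- exists n%:R, gamma; split=> //.
  + by rewrite -[0]/(0%:R) gamma_nat a0.
  + by rewrite gamma_nat an.
  + move=> t t'; rewrite !in_itv /= => t0 t'0; apply/eqP; rewrite eq_le; apply/andP; split.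
      apply: cayley_dist_le; case: (leP t t') => [tt'|/ltW tt'].
        by have [] := short t t' t0 t'0 tt'.
      by have [] := short t' t t'0 t0 tt'.
    by have := vdist_le_cayley x (gamma t) (gamma t'); rewrite !vg.
- move=> k kn; exists k%:R; last exact: gamma_nat.
  by rewrite /= in_itv /= ler0n ler_nat.
- move=> p [t]; rewrite /= in_itv /= => /up [k [kn kt arc]] <-; exists k => // v.
  by have /andP [k1 k2] := kt; have [_ h] := vdist_arc v arc; lra.
Qed.

Lemma hyperbolic_thin_paths delta : 0 <= delta -> delta_hyperbolic cdist delta ->
  exists e, thin_paths genS e.
Proof.
move=> delta0 hyp; exists (Num.bound (delta + 1)).
move=> x y z a b c ga gb gc i ixy.
have [A [Aseg Av _]] := geodesic_path_segment ga.
have [B [Bseg _ Bnear]] := geodesic_path_segment gb.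
have [B' [Cseg _ Cnear]] := geodesic_path_segment gc.
have [sub _ _] := hyp _ _ _ _ _ _ Aseg Bseg Cseg.
have bound k (g : nat -> C) q : cdist (vertex (a i)) q <= delta ->
    (forall v, (d v (g k))%:R <= vdist v q + 1) ->
    (d (a i) (g k) <= Num.bound (delta + 1))%N.
  move=> dq gk; rewrite -(ler_nat R); apply: ltW.
  apply: le_lt_trans (archi_boundP _); last by lra.
  have := le_trans (vdist_le_cayley (a i) (vertex (a i)) q) dq.
  have -> : vdist (a i) (vertex (a i)) = 0.
    by rewrite /= /gdist monoid.mulVg word_length1.
  by rewrite ler_norml => /andP [q1 q2]; have := gk (a i); lra.
have [q [Bq|Cq] dq] := sub _ (Av i ixy).
  by left; have [k kn gk] := Bnear q Bq; exists k => //; exact: bound dq gk.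
by right; have [k kn gk] := Cnear q Cq; exists k => //; exact: bound dq gk.
Qed.

End CayleyMetric.

Lemma word_hyperbolic_length (R : realType) (C : groupType) :
  word_hyperbolic R C -> exists len D, @hyperbolic_length C len D.
Proof.
move=> [S genS [delta delta0 hyp]].
have [e thin] := hyperbolic_thin_paths genS delta0 hyp.
by eexists; eexists; exact: thin_paths_four_point thin.
Qed.

(** * Triviality of the Frattini subgroup *)

Theorem corollaryB (R : realType) (G : groupType)
    (hfg : finitely_generated G)
    (hres : residually_torsion_free_hyperbolic R G) :
  Frattini G = [set (1 : G)%g]%classic.
Proof.
apply/seteqP; split=> [g Fg|_ ->]; last first.
  by have [] := Frattini_subgroup G.
apply: contrapT => /hres [C [tf /word_hyperbolic_length [len [D hyp]] [phi ne]]].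
by apply: ne; apply: (Frattini_in_kernel hfg hyp tf _ Fg); exact: gmulfM.
Qed.
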